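(* Let $X:[0,1]\to\mathcal{H}(n)$ be a smooth curve and let $\beta:[0,1]\to\mathcal{U}(n)$ be the smooth curve $\beta(t)=e^{iX(t)}$, $t\in[0,1]$. Then: 1. $L(\beta)\le L(X)$, both lengths being measured with the trace norm. 2. If $Y:[0,1]\to\mathcal{H}(n)$ is a smooth curve that is minimal in $\mathcal{H}(n)$ for the trace norm, with $Y(0)=0$ and $\|Y(1)\|_\infty\le\pi$, then its exponential $\alpha(t)=e^{iY(t)}$ is a minimal curve in $\mathcal{U}(n)$ for the trace norm.
   Context: $\mathcal{H}(n)$ is the real vector space of $n\times n$ complex Hermitian matrices and $\mathcal{U}(n)$ the unitary group. $\|\cdot\|_\infty$ is the spectral (operator) norm and $\|A\|_1=\mathrm{tr}\,|A|$ is the trace norm. In both $\mathcal{H}(n)$ and $\mathcal{U}(n)$ the length of a curve $\gamma:[0,1]\to M_n(\mathbb{C})$ lying in the space is $L(\gamma)=\int_0^1\|\dot\gamma(t)\|_1dt$; a curve is minimal if it has the least length among piecewise smooth curves in that space with the same endpoints. *)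

(* Defs.v *)
From mathcomp Require Export all_boot all_order all_algebra.
From mathcomp Require Export all_classical all_reals all_analysis.
From mathcomp Require Export complex spectral.

Set Implicit Arguments.
Unset Strict Implicit.
Unset Printing Implicit Defensive.

Export Order.TTheory GRing.Theory Num.Theory.
Export numFieldNormedType.Exports.

Local Open Scope classical_set_scope.
Local Open Scope complex_scope.
Local Open Scope sesquilinear_scope.
Local Open Scope ring_scope.

Section Matrices.
Context {R : realType} {n : nat}.
Implicit Types A : 'M[R[i]]_n.

Definition hermitian_set : set 'M[R[i]]_n := [set A | A \is hermsymmx].

Definition unitary_set : set 'M[R[i]]_n := [set A | A \is unitarymx].

Definition mexp A : 'M[R[i]]_n :=
  lim (series (fun k => (k`!%:R)^-1 *: A ^+ k) @ \oo).

(* |A| is the positive square root of A^* A, taken on the eigenvalues given by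
   the unitary diagonalization of A^* A. *)
Definition absmx A : 'M[R[i]]_n :=
  let B := A ^t* *m A in
  invmx (spectralmx B) *m diag_mx (map_mx sqrtC (spectral_diag B))
    *m spectralmx B.

(* The trace is real, being a sum of square roots of nonnegative reals; Re only
   moves it from R[i] to R. *)
Definition trace_norm A : R := complex.Re (\tr (absmx A)).

Definition l2norm (v : 'cV[R[i]]_n) : R :=
  Num.sqrt (\sum_i Normc.normc (v i 0) ^+ 2).

Definition spectral_norm A : R :=
  sup [set l2norm (A *m v) | v in [set v | l2norm v <= 1]].

End Matrices.

(* A curve on [0, 1] is a total function on R of which only the values on
   [0, 1] are meaningful. *)
Section Curves.
Context {R : realType} {n : nat}.
Implicit Types (f g : R -> 'M[R[i]]_n) (S : set 'M[R[i]]_n).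

Definition Re_entry f (i j : 'I_n) : R -> R := fun t => complex.Re (f t i j).
Definition Im_entry f (i j : 'I_n) : R -> R := fun t => complex.Im (f t i j).

Definition velocity f (t : R) : 'M[R[i]]_n :=
  \matrix_(i, j) (derive1 (Re_entry f i j) t +i* derive1 (Im_entry f i j) t).

(* C^oo on the whole real line *)
Definition smooth f : Prop :=
  forall (i j : 'I_n) (k : nat) (t : R),
    derivable (derive1n k (Re_entry f i j)) t 1 /\
    derivable (derive1n k (Im_entry f i j)) t 1.

(* Smoothness on a closed interval is the existence of a C^oo extension. *)
Definition smooth_on (a b : R) f : Prop :=
  exists g, smooth g /\ forall t, a <= t <= b -> f t = g t.

(* Consecutive closed pieces share their endpoints, so such a curve is
   continuous on [0, 1]. *)
Definition piecewise_smooth f : Prop :=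
  exists s : seq R, itv_partition 0 1 s /\
    forall k, (k < size s)%N ->
      smooth_on (nth 0 (0 :: s) k) (nth 0 s k) f.

Definition lies_in S f : Prop := forall t, 0 <= t <= 1 -> S (f t).

(* The derivative at 0 and 1 may depend on values outside [0, 1], but these two
   points, like the breakpoints of a piecewise smooth curve, are negligible. *)
Definition curve_length f : \bar R :=
  (\int[lebesgue_measure]_(t in `[0%R, 1%R]) (trace_norm (velocity f t))%:E)%E.

Definition minimal_curve S f : Prop :=
  [/\ piecewise_smooth f, lies_in S f &
    forall g, piecewise_smooth g -> lies_in S g -> g 0 = f 0 -> g 1 = f 1 ->
      (curve_length f <= curve_length g)%E].

Definition exp_curve f : R -> 'M[R[i]]_n := fun t => mexp ('i%C *: f t).

End Curves.

(* Main.v *)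
Require Import Defs.
From mathcomp Require Import measurable_realfun.
From mathcomp Require Import ring lra.

(* The trace norm is dual to the contractions: |A|_1 is the maximum of
   |tr (K A)| over contractions K.

   For the first part, if A and B are hermitian then e^{iA} - e^{iB} telescopes
   into N terms, each of trace norm at most that of
   e^{iA/N} - e^{iB/N} = i (A - B) / N + O(1 / N^2), so that
   |e^{iA} - e^{iB}|_1 <= |A - B|_1; the speeds compare in the limit.

   For the second part, comparing Y with the segment from 0 to Y(1) gives
   L(e^{iY}) <= L(Y) <= |Y(1)|_1.  Conversely let g be a curve in the unitary
   group from 1 to e^{iY(1)}.  For a real polynomial q the function tr q(C),
   C = (g + g^* ) / 2, has derivative tr (q'(C) C') = tr (K g') for some normal
   matrix K that is diagonal together with g, with entries of modulus
   |q'(cos a) sin a| at the eigenvalue e^{ia}; no regularity of the eigenvalues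
   is needed.  If |q'(x)| sqrt(1 - x^2) <= 1 on [-1, 1] then K is a contraction,
   and integrating bounds L(g) below by the sum of the q(1) - q(cos m_j), where
   the m_j are the eigenvalues of Y(1).  Such q approximate -arccos, and
   arccos (cos m_j) = |m_j| since |m_j| <= pi. *)

Set Implicit Arguments.
Unset Strict Implicit.
Unset Printing Implicit Defensive.

Local Open Scope classical_set_scope.
Local Open Scope ring_scope.

(** * Contractions and the trace norm *)

Section TraceNorm.
Local Open Scope complex_scope.
Local Open Scope sesquilinear_scope.
Context {R : realType}.
Local Notation C := R[i].

Lemma dotmx_sqr n (u : 'rV[C]_n) : dotmx u u = \sum_j `|u 0 j| ^+ 2.
Proof.
by rewrite dotmxE mxE; apply: eq_bigr => j _; rewrite !mxE -normCK.
Qed.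

Lemma dotmx_unitary n (U : 'M[C]_n) (u : 'rV[C]_n) :
  U \is unitarymx -> dotmx (u *m U) (u *m U) = dotmx u u.
Proof.
move=> Uu; rewrite !dotmxE trmx_mul map_mxM mulmxA -(mulmxA u).
by rewrite (unitarymxP Uu) mulmx1.
Qed.

(** Vectors are rows because [dotmx] takes rows; the comparison is between squared lengths, which
    are real elements of [R[i]]. *)
Definition contraction n (K : 'M[C]_n) :=
  forall u : 'rV[C]_n, dotmx (u *m K) (u *m K) <= dotmx u u.

Lemma contraction_unitary n (U : 'M[C]_n) : U \is unitarymx -> contraction U.
Proof. by move=> Uu u; rewrite dotmx_unitary. Qed.

Lemma contractionM n (K L : 'M[C]_n) :
  contraction K -> contraction L -> contraction (K *m L).
Proof. by move=> hK hL u; rewrite mulmxA (le_trans (hL _)). Qed.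

Lemma contraction_diag n (d : 'rV[C]_n) :
  (forall j, `|d 0 j| <= 1) -> contraction (diag_mx d).
Proof.
move=> hd u; rewrite !dotmx_sqr ler_sum// => j _.
rewrite mul_mx_diag mxE normrM exprMn ler_piMr ?exprn_ge0//.
by rewrite exprn_ile1.
Qed.

Lemma unitarymxKt n (U : 'M[C]_n) : U \is unitarymx -> U^t* *m U = 1%:M.
Proof.
move=> Uu; have : U^t* \is unitarymx by rewrite trmxC_unitary.
by move=> /unitarymxP; rewrite trmxCK.
Qed.

Lemma contraction_spectral n (V : 'M[C]_n) (d : 'rV[C]_n) :
  V \is unitarymx -> (forall j, `|d 0 j| <= 1) ->
  contraction (V^t* *m diag_mx d *m V).
Proof.
move=> Vu hd; apply: contractionM; last exact: contraction_unitary.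
apply: contractionM; last exact: contraction_diag.
by apply: contraction_unitary; rewrite trmxC_unitary.
Qed.

Lemma contraction_entry n (K : 'M[C]_n) i j : contraction K -> `|K i j| <= 1.
Proof.
move=> /(_ (delta_mx 0 i)); rewrite -rowE !dotmx_sqr.
have -> : \sum_k `|(delta_mx 0 i : 'rV[C]_n) 0 k| ^+ 2 = 1.
  rewrite (bigD1 i)//= big1 => [|k /negbTE ki]; rewrite !mxE ?ki ?eqxx.
    by rewrite normr1 expr1n addr0.
  by rewrite normr0 expr0n.
move=> h.
rewrite -(@expr_le1 _ 2)//; apply: le_trans h.
by rewrite (bigD1 j)//= !mxE lerDl sumr_ge0// => k _; rewrite exprn_ge0.
Qed.

Lemma mxtrace_conj n (V A : 'M[C]_n) :
  V \is unitarymx -> \tr (V *m A *m V^t*) = \tr A.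
Proof. by move=> Vu; rewrite mxtrace_mulC mulmxA unitarymxKt// mul1mx. Qed.

Section Decomposition.
Context n (A : 'M[C]_n).
(** [s] lists the squares of the singular values of [A], and the columns of [W^t*] are the right
    singular vectors. *)
Let B := A^t* *m A.
Let W := spectralmx B.
Let s := spectral_diag B.

Let Wu : W \is unitarymx. Proof. exact: spectral_unitarymx. Qed.

Let BE : B = W^t* *m diag_mx s *m W.
Proof.
rewrite -invmx_unitary//; apply/orthomx_spectralP/hermitian_normalmx.
apply/is_hermitianmxP; rewrite expr0 scale1r /B.
by rewrite trmx_mul map_mxM trmxCK.
Qed.

(** The columns of [A *m W^t*] are thus orthogonal with squared lengths [s]: this half of the
    singular value decomposition carries both sides of the duality. *)
Let colE : (A *m W^t*)^t* *m (A *m W^t*) = diag_mx s.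
Proof.
rewrite trmx_mul map_mxM trmxCK mulmxA -(mulmxA W) -/B BE !mulmxA.
by rewrite (unitarymxP Wu) mul1mx mulmxtVK.
Qed.

Let row_colE j :
  dotmx (row j ((A *m W^t*)^t*)) (row j ((A *m W^t*)^t*)) = s 0 j.
Proof.
have /matrixP/(_ j j) := colE; rewrite dotmxE !mxE eqxx mulr1n => <-.
by apply: eq_bigr => k _; rewrite !mxE conjCK.
Qed.

Let s_ge0 j : 0 <= s 0 j.
Proof.
rewrite -row_colE dotmx_sqr.
by rewrite sumr_ge0// => k _; rewrite exprn_ge0.
Qed.

Lemma trace_normE : (trace_norm A)%:C = \sum_j sqrtC (s 0 j).
Proof.
rewrite /trace_norm /absmx -/B -/W -/s mxtrace_mulC mulmxA mulmxV ?spectral_unit//.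
rewrite mul1mx mxtrace_diag RRe_real; last first.
  by rewrite rpred_sum// => j _; rewrite mxE ger0_real// sqrtC_ge0.
by apply: eq_bigr => j _; rewrite mxE.
Qed.

(** In the basis given by [W] the trace is a sum of scalar products of [row j W *m K], of length at
    most 1, with a vector of length [sqrtC (s 0 j)]. Cauchy-Schwarz bounds each term. *)
Lemma mxtrace_contraction (K : 'M[C]_n) :
  contraction K -> `|\tr (K *m A)| <= (trace_norm A)%:C.
Proof.
move=> hK; rewrite trace_normE.
rewrite -(mxtrace_conj (K *m A) Wu) !mulmxA -mulmxA [\tr _]/mxtrace.
rewrite (le_trans (ler_norm_sum _ _ _))// ler_sum// => j _.
have -> : (W *m K *m (A *m W^t*)) j j =
    dotmx (row j W *m K) (row j ((A *m W^t*)^t*)).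
  rewrite -row_mul dotmxE !mxE; apply: eq_bigr => k _.
  by rewrite [row _ _ _ _]mxE !mxE; congr (_ * _); rewrite conjCK.
have [/= /le_trans h _] := CauchySchwarz_sqrt (@dotmx C n) (row j W *m K)
  (row j ((A *m W^t*)^t*)).
apply: h; rewrite row_colE.
rewrite ler_piMl ?sqrtC_ge0//.
have := hK (row j W); have /row_unitarymxP/(_ j j) := Wu; rewrite eqxx => -> h.
rewrite -sqrtC1 ler_sqrtC// nnegrE ?ler01//.
by rewrite dotmx_sqr sumr_ge0// => k _; rewrite exprn_ge0.
Qed.

Lemma trace_norm_attained :
  exists2 K : 'M[C]_n, contraction K & \tr (K *m A) = (trace_norm A)%:C.
Proof.
(* The maximizer is the adjoint of the partial isometry in the polar decomposition of [A]. Since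
   [0^-1 = 0], zero singular values drop out and [A] may be singular. *)
pose t : 'rV[C]_n := \row_j (sqrtC (s 0 j))^-1.
exists (W^t* *m diag_mx t *m W *m A^t*); last first.
  rewrite trace_normE -!mulmxA -/B BE !mulmxA mulmxtVK// mxtrace_mulC.
  rewrite !mulmxA (unitarymxP Wu) mul1mx mulmx_diag mxtrace_diag.
  apply: eq_bigr => j _; rewrite !mxE -{2}(sqrtCK (s 0 j)).
  have [->|h] := eqVneq (sqrtC (s 0 j)) 0; first by rewrite expr0n mulr0.
  by rewrite expr2 mulKf.
have Wtu : W^t* \is unitarymx by rewrite trmxC_unitary.
move=> u; rewrite -(dotmx_unitary u Wtu).
set w := u *m W^t*; have -> : u *m (W^t* *m diag_mx t *m W *m A^t*) =
   w *m diag_mx t *m (W *m A^t*) by rewrite !mulmxA.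
move: w => {u}w; rewrite dotmxE trmx_mul map_mxM mulmxA -(mulmxA (w *m _)).
have -> : W *m A^t* *m (W *m A^t*)^t* = diag_mx s.
  rewrite -colE; congr (_ *m _); first by rewrite trmx_mul map_mxM trmxCK.
  by rewrite trmx_mul map_mxM trmxCK.
rewrite mxE dotmx_sqr ler_sum// => j _.
rewrite !mul_mx_diag !mxE.
have r_ge0 : 0 <= sqrtC (s 0 j) by rewrite sqrtC_ge0.
rewrite rmorphM /= fmorphV /= (geC0_conj r_ge0).
have [h|h] := eqVneq (sqrtC (s 0 j)) 0.
  by rewrite h invr0 !(mulr0, mul0r) exprn_ge0.
rewrite -{2}(sqrtCK (s 0 j)) normCK [leLHS](_ : _ = w 0 j * Num.conj (w 0 j))//.
by field.
Qed.

End Decomposition.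
End TraceNorm.

(** * Norm properties of the trace norm, deduced from the duality *)

Section TraceNormTheory.
Local Open Scope complex_scope.
Local Open Scope sesquilinear_scope.
Context {R : realType}.
Local Notation C := R[i].
Local Notation normc := Normc.normc.

Lemma normC_normc (z : C) : `|z| = (normc z)%:C.
Proof. by case: z. Qed.

Lemma normc_ge0 (z : C) : 0 <= normc z.
Proof. by rewrite -ler0c -normC_normc. Qed.

Lemma Re_le_normc (z : C) : complex.Re z <= normc z.
Proof. by apply: le_trans (ler_norm _) _; rewrite -lecR -normC_normc normc_ge_Re. Qed.

Lemma normc_le_add (z : C) : normc z <= `|complex.Re z| + `|complex.Im z|.
Proof.
case: z => a b /=; rewrite -(ger0_norm (addr_ge0 (normr_ge0 a) (normr_ge0 b))).
rewrite -sqrtr_sqr ler_sqrt ?sqr_ge0//.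
rewrite sqrrD !real_normK ?num_real//.
by have := normr_ge0 a; have := normr_ge0 b; nra.
Qed.

Lemma trace_norm_ge0 n (A : 'M[C]_n) : 0 <= trace_norm A.
Proof.
have [K hK tK] := trace_norm_attained A.
by rewrite -ler0c; apply: le_trans (normr_ge0 _) (mxtrace_contraction A hK).
Qed.

Lemma trace_norm_le n (A : 'M[C]_n) (c : R) :
  (forall K, contraction K -> `|\tr (K *m A)| <= c%:C) -> trace_norm A <= c.
Proof.
have [K hK tK] := trace_norm_attained A.
move=> /(_ _ hK); rewrite tK ger0_norm ?ler0c ?trace_norm_ge0//.
by rewrite lecR.
Qed.

Lemma Re_mxtrace_contraction n (K A : 'M[C]_n) :
  contraction K -> complex.Re (\tr (K *m A)) <= trace_norm A.
Proof.
move=> hK; apply: le_trans (Re_le_normc _) _.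
by rewrite -lecR -normC_normc mxtrace_contraction.
Qed.

Lemma trace_normD n (A B : 'M[C]_n) :
  trace_norm (A + B) <= trace_norm A + trace_norm B.
Proof.
apply: trace_norm_le => K hK; rewrite mulmxDr mxtraceD rmorphD.
by rewrite (le_trans (ler_normD _ _))// lerD// mxtrace_contraction.
Qed.

Lemma trace_norm0 n : trace_norm (0 : 'M[C]_n) = 0.
Proof.
apply/eqP; rewrite eq_le trace_norm_ge0 andbT.
by apply: trace_norm_le => K _; rewrite mulmx0 mxtrace0 normr0.
Qed.

Lemma trace_normZ n (c : C) (A : 'M[C]_n) :
  trace_norm (c *: A) = normc c * trace_norm A.
Proof.
have le_tn k (M : 'M[C]_n) : trace_norm (k *: M) <= normc k * trace_norm M.
  apply: trace_norm_le => K hK; rewrite -scalemxAr mxtraceZ normrM rmorphM.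
  by rewrite normC_normc ler_wpM2l ?ler0c ?normc_ge0// mxtrace_contraction.
have [->|c0] := eqVneq c 0; first by rewrite scale0r trace_norm0 Normc.normc0 mul0r.
apply/eqP; rewrite eq_le le_tn/=.
(* The reverse inequality comes from [le_tn] for the scalar [c^-1] and the matrix [c *: A]. *)
rewrite -[A in X in X <= _]scale1r -(mulVf c0) -scalerA.
apply: le_trans (ler_wpM2l (normc_ge0 c) (le_tn _ _)) _.
by rewrite mulrA -Normc.normcM divff// Normc.normc1 mul1r.
Qed.

Lemma trace_normN n (A : 'M[C]_n) : trace_norm (- A) = trace_norm A.
Proof.
rewrite -scaleN1r trace_normZ (_ : normc (-1 : C) = 1) ?mul1r//.
by apply: complexI; rewrite -normC_normc normrN1.
Qed.

Lemma trace_norm_contraction n (K L A : 'M[C]_n) :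
  contraction K -> contraction L -> trace_norm (K *m A *m L) <= trace_norm A.
Proof.
move=> hK hL; apply: trace_norm_le => M hM.
have -> : M *m (K *m A *m L) = M *m K *m A *m L by rewrite !mulmxA.
have -> : \tr (M *m K *m A *m L) = \tr (L *m M *m K *m A).
  by rewrite mxtrace_mulC !mulmxA.
exact: (mxtrace_contraction A (contractionM (contractionM hL hM) hK)).
Qed.

(** Entries of a contraction have modulus at most 1. The bound is crude, but it turns entrywise
    convergence into convergence of the trace norm. *)
Lemma trace_norm_le_entries n (A : 'M[C]_n) :
  trace_norm A <= \sum_i \sum_j normc (A i j).
Proof.
apply: trace_norm_le => K hK; rewrite [\tr _]/mxtrace.
rewrite exchange_big/= rmorph_sum (le_trans (ler_norm_sum _ _ _))// ler_sum//.
move=> i _; rewrite mxE rmorph_sum (le_trans (ler_norm_sum _ _ _))// ler_sum//.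
move=> j _; rewrite normrM /= -normC_normc ler_piMl//.
exact: contraction_entry.
Qed.

Lemma trace_norm_spectral n (V : 'M[C]_n) (d : 'rV[C]_n) : V \is unitarymx ->
  trace_norm (V^t* *m diag_mx d *m V) <= \sum_j normc (d 0 j).
Proof.
move=> Vu; apply: (@le_trans _ _ (trace_norm (diag_mx d))).
  by apply: trace_norm_contraction; apply: contraction_unitary;
    rewrite ?trmxC_unitary.
apply: trace_norm_le => K hK; rewrite [\tr _]/mxtrace.
rewrite rmorph_sum (le_trans (ler_norm_sum _ _ _))// ler_sum// => j _.
rewrite mul_mx_diag mxE normrM /= -normC_normc ler_piMl//.
exact: contraction_entry.
Qed.

Lemma trace_norm_lipschitz n (A B : 'M[C]_n) :
  `|trace_norm A - trace_norm B| <= trace_norm (A - B).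
Proof.
have h (M N : 'M[C]_n) : trace_norm M - trace_norm N <= trace_norm (M - N).
  by rewrite lerBlDr; apply: le_trans _ (trace_normD _ _); rewrite subrK.
by rewrite ler_norml h andbT lerNl opprB -(trace_normN (A - B)) opprB h.
Qed.

End TraceNormTheory.

(** * Entrywise limits and the exponential series *)

(** Link to the topological limit in the definition of [mexp]; the radius [e] is a positive element
    of the field itself. Later limits are handled through real and imaginary parts. *)
Lemma mx_lim (K : numFieldType) m n (f : nat -> 'M[K]_(m, n)) (L : 'M[K]_(m, n)) :
  (forall e : K, 0 < e ->
    \forall k \near \oo, forall i j, `|L i j - f k i j| < e) ->
  lim (f @ \oo) = L.
Proof.
move=> h; apply: cvg_lim; first exact: norm_hausdorff.
apply/cvg_ballP => e e0; have := h e e0.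
by apply: filterS => k hk; split => // i j; exact: hk.
Qed.

Section ComplexLimits.
Local Open Scope complex_scope.
Local Open Scope sesquilinear_scope.
Context {R : realType}.
Local Notation C := R[i].
Local Notation normc := Normc.normc.

(** Indexing the two real coordinates by a boolean lets one argument over [R] treat both at once. *)
Definition part (b : bool) (z : C) : R := if b then complex.Re z else complex.Im z.

Lemma part_inj (x y : C) : (forall b, part b x = part b y) -> x = y.
Proof.
case: x y => [a b] [c d] h.
by have /= -> := h true; have /= -> := h false.
Qed.

Lemma part0 b : part b 0 = 0. Proof. by case: b. Qed.

Lemma partD b x y : part b (x + y) = part b x + part b y.
Proof. by case: b x y => -[? ?] [? ?]. Qed.

Lemma partN b x : part b (- x) = - part b x.
Proof. by case: b x => -[? ?]. Qed.

Lemma partB b x y : part b (x - y) = part b x - part b y.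
Proof. by rewrite partD partN. Qed.

Lemma part_sum b I (r : seq I) (P : pred I) (f : I -> C) :
  part b (\sum_(i <- r | P i) f i) = \sum_(i <- r | P i) part b (f i).
Proof. by apply: (big_morph (part b) (partD b) (part0 b)). Qed.

Lemma partM b x y : part b (x * y) =
  part true x * part b y + (-1) ^+ b * (part false x * part (~~ b) y).
Proof. by case: b x y => -[a a'] [c c'] /=; ring. Qed.

Lemma partZ b (s : R) x : part b (s%:C * x) = s * part b x.
Proof. by rewrite partM /= mul0r mulr0 addr0. Qed.

Lemma le_part b x : `|part b x| <= normc x.
Proof.
case: b x => -[a a'] /=; rewrite -sqrtr_sqr ler_sqrt ?addr_ge0 ?sqr_ge0//.
  by rewrite lerDl sqr_ge0.
by rewrite lerDr sqr_ge0.
Qed.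

Lemma normc_le_part x c : (forall b, `|part b x| <= c) -> normc x <= 2 * c.
Proof.
move=> h; apply: le_trans (normc_le_add x) _.
by have := lerD (h true) (h false); rewrite mulr_natl.
Qed.

Section Limits.
Context {T : Type} (F : set_system T) {FF : Filter F}.

Definition ccvg (f : T -> C) (l : C) :=
  forall b, (fun x => part b (f x)) @ F --> part b l.

Lemma ccvg_cst (l : C) : ccvg (fun=> l) l.
Proof. by move=> b; exact: cvg_cst. Qed.

Lemma ccvgD f g k l : ccvg f k -> ccvg g l -> ccvg (fun x => f x + g x) (k + l).
Proof.
move=> hf hg b; rewrite partD.
under eq_fun do rewrite partD.
exact: cvgD (hf b) (hg b).
Qed.

Lemma ccvgN f k : ccvg f k -> ccvg (fun x => - f x) (- k).
Proof.
move=> hf b; rewrite partN.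
under eq_fun do rewrite partN.
exact: cvgN (hf b).
Qed.

Lemma ccvgM f g k l : ccvg f k -> ccvg g l -> ccvg (fun x => f x * g x) (k * l).
Proof.
move=> hf hg b; rewrite partM.
under eq_fun do rewrite partM.
by apply: cvgD; [|apply: cvgM; [exact: cvg_cst|]]; apply: cvgM;
  exact: (hf) || exact: hg.
Qed.

Lemma ccvg_sum I (r : seq I) (f : I -> T -> C) (l : I -> C) :
  (forall i, ccvg (f i) (l i)) ->
  ccvg (fun x => \sum_(i <- r) f i x) (\sum_(i <- r) l i).
Proof.
move=> h; elim: r => [|i r IH].
  rewrite big_nil; under eq_fun do rewrite big_nil; exact: ccvg_cst.
rewrite big_cons; under eq_fun do rewrite big_cons; exact: ccvgD.
Qed.

Lemma ccvg_unique {PF : ProperFilter F} f k l : ccvg f k -> ccvg f l -> k = l.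
Proof.
by move=> hk hl; apply: part_inj => b; apply: (cvg_unique _ (hk b) (hl b)).
Qed.

Definition mxcvg m n (f : T -> 'M[C]_(m, n)) (L : 'M[C]_(m, n)) :=
  forall i j, ccvg (fun x => f x i j) (L i j).

Lemma mxcvg_cst m n (L : 'M[C]_(m, n)) : mxcvg (fun=> L) L.
Proof. by move=> i j; exact: ccvg_cst. Qed.

Lemma mxcvgD m n (f g : T -> 'M[C]_(m, n)) K L :
  mxcvg f K -> mxcvg g L -> mxcvg (fun x => f x + g x) (K + L).
Proof.
move=> hf hg i j; rewrite mxE; under eq_fun do rewrite mxE.
exact: ccvgD.
Qed.

Lemma mxcvgM m n p (f : T -> 'M[C]_(m, n)) (g : T -> 'M[C]_(n, p)) K L :
  mxcvg f K -> mxcvg g L -> mxcvg (fun x => f x *m g x) (K *m L).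
Proof.
move=> hf hg i j; rewrite mxE; under eq_fun do rewrite mxE.
by apply: ccvg_sum => k; exact: ccvgM.
Qed.

Lemma mxcvg_unique {PF : ProperFilter F} m n (f : T -> 'M[C]_(m, n)) K L :
  mxcvg f K -> mxcvg f L -> K = L.
Proof.
by move=> hK hL; apply/matrixP => i j; apply: ccvg_unique (hK i j) (hL i j).
Qed.

End Limits.

Lemma mxcvg_near T (F : set_system T) {FF : Filter F} m n
    (f : T -> 'M[C]_(m, n)) (L : 'M[C]_(m, n)) (e : R) :
  mxcvg F f L -> 0 < e ->
  \forall x \near F, forall i j, normc (L i j - f x i j) < e.
Proof.
move=> h e0.
have H b : \forall x \near F, forall i j,
    `|part b (L i j) - part b (f x i j)| < e / 4.
  apply: filter_forall => i; apply: filter_forall => j.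
  by move/cvgrPdist_lt: (h i j b); apply; rewrite divr_gt0.
move: (H true) (H false); apply: filterS2 => k h1 h2 i j.
apply: (@le_lt_trans _ _ (2 * (e / 4))); last by lra.
by apply: normc_le_part => -[]; rewrite partB ltW.
Qed.

Definition mexp_series n (A : 'M[C]_n) (N : nat) : 'M[C]_n :=
  \sum_(0 <= k < N) (k`!%:R)^-1 *: A ^+ k.

Lemma mexp_eq n (A L : 'M[C]_n) : mxcvg \oo (mexp_series A) L -> mexp A = L.
Proof.
move=> h; apply: mx_lim => e e0.
have e0' : 0 < complex.Re e by move: e0; rewrite ltcE => /andP[].
(* A positive element of [R[i]] is real, so its real part can serve as the radius. *)
have eE : e = (complex.Re e)%:C by rewrite RRe_real// gtr0_real.
apply: filterS (mxcvg_near h e0') => k hk i j.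
by rewrite normC_normc eE ltcR; exact: hk.
Qed.

Lemma normc_sum I (r : seq I) (f : I -> C) :
  normc (\sum_(i <- r) f i) <= \sum_(i <- r) normc (f i).
Proof.
rewrite -lecR -normC_normc rmorph_sum/=; apply: le_trans (ler_norm_sum _ _ _) _.
by apply: ler_sum => i _; rewrite -normC_normc.
Qed.

Lemma normc_expmx n (A : 'M[C]_n) c : (forall i j, normc (A i j) <= c) ->
  forall k i j, normc ((A ^+ k) i j) <= (n%:R * c) ^+ k.
Proof.
move=> hA; elim=> [|k IH] i j.
  rewrite !expr0 -[1]/(1%:M) mxE -lecR -normC_normc normr_nat.
  by rewrite lern1; case: (_ == _).
rewrite !exprS -[_ * _ ^+ k in X in X <= _]/(A *m A ^+ k) mxE.
apply: le_trans (normc_sum _ _) _.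
apply: (@le_trans _ _ (\sum_(l < n) c * (n%:R * c) ^+ k)); last first.
  by rewrite sumr_const card_ord -[leLHS]mulr_natl mulrA.
by apply: ler_sum => l _; rewrite Normc.normcM ler_pM ?normc_ge0.
Qed.

Section Exponential.
Context {n : nat} (A : 'M[C]_n) (c : R).
Hypothesis c_ge0 : 0 <= c.
Hypothesis hA : forall i j, normc (A i j) <= c.

Let r b i j : R^nat := fun k => part b (((k`!%:R)^-1 *: A ^+ k) i j).

Let series_r b i j : series (r b i j) = fun N => part b (mexp_series A N i j).
Proof. by apply/funext => N; rewrite /mexp_series summxE part_sum. Qed.

Let r_le b i j k : `|r b i j k| <= exp_coeff (n%:R * c) k.
Proof.
have -> : r b i j k = (k`!%:R)^-1 * part b ((A ^+ k) i j).
  by rewrite /r mxE -partZ; congr part; rewrite fmorphV rmorph_nat.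
rewrite normrM /exp_coeff/= ger0_norm// [leRHS]mulrC ler_wpM2l//.
by apply: le_trans (le_part _ _) _; exact: normc_expmx.
Qed.

Let exp_coeff_nneg k : 0 <= exp_coeff (n%:R * c) k.
Proof. by rewrite exp_coeff_ge0// mulr_ge0. Qed.

Let cvg_normed_r b i j : cvgn [normed series (r b i j)].
Proof.
apply: (@series_le_cvg _ _ (exp_coeff (n%:R * c))) => [k|k|k|].
- exact: normr_ge0.
- exact: exp_coeff_nneg.
- exact: r_le.
- exact: is_cvg_series_exp_coeff.
Qed.

(** The coordinates of each entry are real series dominated by the exponential series at [n%:R * c],
    hence absolutely convergent. *)
Lemma mexp_cvg : mxcvg \oo (mexp_series A) (mexp A).
Proof.
pose L : 'M[C]_n := \matrix_(i, j) (limn (series (r true i j)) +i*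
  limn (series (r false i j))).
suff hL : mxcvg \oo (mexp_series A) L by rewrite (mexp_eq hL).
move=> i j b; rewrite -series_r mxE.
by case: b; apply: normed_cvg; exact: cvg_normed_r.
Qed.

(** The bound involves only the size and [c]. Applied to block matrices it yields the Lipschitz
    estimate for [mexp]. *)
Lemma part_mexp_le b i j : `|part b (mexp A i j)| <= expR (n%:R * c).
Proof.
have h := @mexp_cvg i j b; rewrite -series_r in h.
rewrite -(cvg_lim _ h)//.
have /le_trans := lim_series_norm (@cvg_normed_r b i j); apply.
apply: lim_series_le => [||k]; first exact: cvg_normed_r.
  exact: is_cvg_series_exp_coeff.
exact: r_le.
Qed.

End Exponential.

Lemma mx_bound m n (A : 'M[C]_(m, n)) :
  exists2 c, 0 <= c & forall i j, normc (A i j) <= c.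
Proof.
exists (\sum_i \sum_j normc (A i j)).
  by apply: sumr_ge0 => i _; apply: sumr_ge0 => j _; exact: normc_ge0.
move=> i j; rewrite (bigD1 i)//= (bigD1 j)//= -addrA lerDl addr_ge0//.
  by apply: sumr_ge0 => k _; exact: normc_ge0.
by apply: sumr_ge0 => k _; apply: sumr_ge0 => l _; exact: normc_ge0.
Qed.

Lemma mexp_is_cvg n (A : 'M[C]_n) : mxcvg \oo (mexp_series A) (mexp A).
Proof. by have [c c0 hc] := mx_bound A; exact: (mexp_cvg c0 hc). Qed.

End ComplexLimits.

(** * Algebraic rules for the matrix exponential *)

Section Exp.
Local Open Scope complex_scope.
Local Open Scope sesquilinear_scope.
Context {R : realType}.
Local Notation C := R[i].
Local Notation normc := Normc.normc.

Lemma mxcvgZ T (F : set_system T) {FF : Filter F} m n (c : C) (f : T -> 'M[C]_(m, n)) L :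
  mxcvg F f L -> mxcvg F (fun x => c *: f x) (c *: L).
Proof.
move=> hf i j; rewrite mxE; under eq_fun do rewrite mxE.
by apply: ccvgM; [exact: ccvg_cst|exact: hf].
Qed.

Lemma mxcvgN T (F : set_system T) {FF : Filter F} m n (f : T -> 'M[C]_(m, n)) L :
  mxcvg F f L -> mxcvg F (fun x => - f x) (- L).
Proof.
move=> hf i j; rewrite mxE; under eq_fun do rewrite mxE.
by apply: ccvgN; exact: hf.
Qed.

Lemma ursubmx_entry m1 m2 n1 n2 (A : 'M[C]_(m1 + m2, n1 + n2)) i j :
  ursubmx A i j = A (lshift m2 i) (rshift n1 j).
Proof. by rewrite !mxE. Qed.

Lemma mxcvg_ursubmx T (F : set_system T) {FF : Filter F} m1 m2 n1 n2
    (f : T -> 'M[C]_(m1 + m2, n1 + n2)) L :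
  mxcvg F f L -> mxcvg F (fun x => ursubmx (f x)) (ursubmx L).
Proof.
move=> hf i j; rewrite ursubmx_entry; under eq_fun do rewrite ursubmx_entry.
exact: hf.
Qed.

Lemma expmxS n (A : 'M[C]_n) k : A ^+ k.+1 = A *m A ^+ k.
Proof. exact: exprS. Qed.

(* The difference quotients of [A ^+ k] are off-diagonal blocks of powers. *)
Lemma expmx_block n (A B : 'M[C]_n) (s : C) k :
  (block_mx A (s *: (A - B)) 0 B) ^+ k =
  block_mx (A ^+ k) (s *: (A ^+ k - B ^+ k)) 0 (B ^+ k).
Proof.
elim: k => [|k IH].
  by rewrite !expr0 subrr scaler0 -scalar_mx_block.
rewrite !expmxS IH mulmx_block !mulmx0 !mul0mx !addr0 !add0r.
congr block_mx; rewrite -scalemxAr -scalemxAl -scalerDr mulmxBr mulmxBl.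
by rewrite addrA subrK.
Qed.

(** The block identity for powers passes to the limit of the series. With [s] the inverse of an
    increment, a difference quotient of [mexp] becomes a block of a value of [mexp]. *)
Lemma mexp_block n (A B : 'M[C]_n) (s : C) :
  ursubmx (mexp (block_mx A (s *: (A - B)) 0 B)) = s *: (mexp A - mexp B).
Proof.
set X := block_mx _ _ _ _.
have h1 : mxcvg \oo (fun N => ursubmx (mexp_series X N)) (ursubmx (mexp X)).
  by apply: mxcvg_ursubmx; exact: mexp_is_cvg.
apply: mxcvg_unique h1 _.
rewrite (_ : (fun _ => _) = fun N => s *: (mexp_series A N - mexp_series B N)).
  apply: mxcvgZ; apply: mxcvgD; first exact: mexp_is_cvg.
  by apply: mxcvgN; exact: mexp_is_cvg.
apply/funext => N; rewrite /mexp_series -sumrB scaler_sumr.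
apply/matrixP => i j; rewrite [LHS]mxE [LHS]mxE !summxE.
apply: eq_bigr => k _; rewrite expmx_block mxE block_mxEur !mxE.
by rewrite -mulrBr mulrCA.
Qed.

Lemma expmx_conj n (V W A : 'M[C]_n) k : V *m W = 1%:M ->
  (W *m A *m V) ^+ k = W *m A ^+ k *m V.
Proof.
move=> VW; elim: k => [|k IH]; first by rewrite !expr0 mulmx1 (mulmx1C VW).
by rewrite !expmxS IH !mulmxA -(mulmxA _ V) VW mulmx1.
Qed.

Lemma mexp_conj n (V W A : 'M[C]_n) : V *m W = 1%:M ->
  mexp (W *m A *m V) = W *m mexp A *m V.
Proof.
move=> VW.
apply: mexp_eq; rewrite (_ : mexp_series _ = fun N => W *m mexp_series A N *m V).
  apply: mxcvgM; last exact: mxcvg_cst.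
  by apply: mxcvgM; [exact: mxcvg_cst|exact: mexp_is_cvg].
apply/funext => N; rewrite /mexp_series mulmx_sumr mulmx_suml.
by apply: eq_bigr => k _; rewrite (expmx_conj _ _ VW) -scalemxAr -scalemxAl.
Qed.

Lemma diag_mx_exp n (d : 'rV[C]_n) k :
  diag_mx d ^+ k = diag_mx (\row_j d 0 j ^+ k).
Proof.
elim: k => [|k IH].
  rewrite expr0; apply/matrixP => i j; rewrite !mxE.
  by case: (i == j).
rewrite exprS IH -[_ * _]/(_ *m _) mulmx_diag; congr diag_mx.
by apply/rowP => j; rewrite !mxE exprS.
Qed.

Definition cis (x : R) : C := cos x +i* sin x.

Lemma part_iexp b k (x : R) :
  part b (('i%C * x%:C) ^+ k / k`!%:R) = (if b then cos_coeff else sin_coeff) x k.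
Proof.
have iE : ('i%C : C) ^+ k = ((-1) ^+ k./2)%:C * (if odd k then 'i%C else 1).
  rewrite -[in LHS](odd_double_half k) exprD -mul2n exprM sqr_i.
  by rewrite rmorphXn rmorphN rmorph1 mulrC; case: odd; rewrite ?expr1 ?expr0.
have -> : ('i%C * x%:C) ^+ k / k`!%:R =
    ((-1) ^+ k./2 * x ^+ k / k`!%:R)%:C * (if odd k then 'i%C else 1).
  rewrite exprMn iE !rmorphM fmorphV rmorph_nat !rmorphXn/=.
  by case: odd; field; rewrite pnatr_eq0 -lt0n fact_gt0.
rewrite partZ /cos_coeff /sin_coeff /=.
case: b; case: (boolP (odd k)) => ok /=; rewrite ?(mulr1, mulr0, mul1r, mul0r)//.
(* [sin_coeff] halves [k.-1] instead of [k]; the two halves agree for odd [k]. *)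
by case: k ok {iE} => // k /= /negbTE ok; rewrite uphalf_half ok.
Qed.

Lemma mexp_diag n (mu : 'I_n -> R) :
  mexp (diag_mx (\row_j ('i%C * (mu j)%:C))) = diag_mx (\row_j cis (mu j)).
Proof.
apply: mexp_eq => i j b; rewrite !mxE.
have [<-|ij] := eqVneq i j; last first.
  rewrite mulr0n (_ : (fun _ => _) = fun=> part b 0); first exact: cvg_cst.
  apply/funext => N; congr part; rewrite /mexp_series summxE big1// => k _.
  by rewrite diag_mx_exp !mxE (negbTE ij) mulr0n mulr0.
rewrite mulr1n.
rewrite (_ : (fun _ => _) =
   series ((if b then cos_coeff else sin_coeff) (mu i))).
  case: b => /=; rewrite unlock; [exact: is_cvg_series_cos_coeff|
    exact: is_cvg_series_sin_coeff].
apply/funext => N; rewrite /mexp_series summxE part_sum.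
apply: eq_bigr => k _; rewrite diag_mx_exp !mxE eqxx mulr1n.
by rewrite mulrC part_iexp.
Qed.

Lemma mexp0 n : mexp (0 : 'M[C]_n) = 1%:M.
Proof.
have -> : 0 = diag_mx (\row_j ('i%C * 0%:C)) :> 'M[C]_n.
  by apply/matrixP => i j; rewrite !mxE mulr0 mul0rn.
rewrite (mexp_diag (fun=> 0)) -diag_const_mx; apply: (congr1 diag_mx).
by apply/rowP => j; rewrite !mxE /cis cos0 sin0.
Qed.

End Exp.

(** * Differentiation of the exponential *)

Section ExpDerivative.
Local Open Scope complex_scope.
Local Open Scope sesquilinear_scope.
Context {R : realType}.
Local Notation C := R[i].
Local Notation normc := Normc.normc.

Lemma normc_block_le n (A D B : 'M[C]_n) (c : R) : 0 <= c ->
  (forall i j, normc (A i j) <= c) -> (forall i j, normc (D i j) <= c) ->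
  (forall i j, normc (B i j) <= c) ->
  forall i j, normc (block_mx A D 0 B i j) <= c.
Proof.
move=> c0 hA hD hB i j.
case: (split_ordP i) => k ->; case: (split_ordP j) => l ->.
- by rewrite block_mxEul.
- by rewrite block_mxEur.
- by rewrite block_mxEdl mxE Normc.normc0.
- by rewrite block_mxEdr.
Qed.

(** With [s = d^-1] the corner block [s *: (A - B)] has entries of modulus at most 1, hence at most
    [c]. So [part_mexp_le] in size [n + n] bounds the difference of the exponentials divided by
    [d]. *)
Lemma mexp_lipschitz n (A B : 'M[C]_n) (c d : R) : 1 <= c -> 0 < d ->
  (forall i j, normc (A i j) <= c) -> (forall i j, normc (B i j) <= c) ->
  (forall i j, normc (A i j - B i j) <= d) ->
  forall b i j, `|part b (mexp A i j - mexp B i j)| <=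
    d * expR ((n + n)%:R * c).
Proof.
move=> c1 d0 hA hB hAB b i j.
have c0 : 0 <= c by apply: le_trans c1.
have hD k l : normc (((d^-1)%:C *: (A - B)) k l) <= c.
  rewrite !mxE Normc.normcM (_ : normc _ = d^-1); last first.
    by apply: complexI; rewrite -normC_normc ger0_norm// ler0c invr_ge0 ltW.
  by apply: le_trans c1; rewrite ler_pdivrMl// mulr1.
have := @part_mexp_le _ _ _ _ c0 (normc_block_le c0 hA hD hB) b
  (lshift n i) (rshift n j).
have /matrixP/(_ i j) := mexp_block A B (d^-1)%:C.
rewrite ursubmx_entry => ->; rewrite !mxE.
by rewrite partZ normrM gtr0_norm ?invr_gt0// ler_pdivrMl.
Qed.

Lemma normc_le_sub (x y : C) : normc x <= normc y + normc (y - x).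
Proof.
rewrite -lecR rmorphD /= -!normC_normc.
by rewrite -{1}[x](subKr y) ler_normB.
Qed.

Lemma mxcvg_mexp T (F : set_system T) {FF : Filter F} n (A : T -> 'M[C]_n) A0 :
  mxcvg F A A0 -> mxcvg F (fun x => mexp (A x)) (mexp A0).
Proof.
move=> hA i j b; have [c c0 hc] := mx_bound A0.
apply/cvgrPdist_le => e e0; set M := expR ((n + n)%:R * (c + 1)).
have M0 : 0 < M by exact: expR_gt0.
(* The 1 keeps the entries of [A x] below [c + 1], where [M] is a Lipschitz constant; the other term
   then makes the change at most [e]. *)
have d0 : 0 < Num.min 1 (e / M) by rewrite lt_min ltr01 divr_gt0.
apply: filterS (mxcvg_near hA d0) => x hx.
rewrite -partB.
have hc1 k l : normc (A0 k l) <= c + 1 by rewrite (le_trans (hc k l))// lerDl.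
have hd k l : normc (A0 k l - A x k l) <= Num.min 1 (e / M) by exact: ltW.
have hx1 k l : normc (A x k l) <= c + 1.
  apply: le_trans (normc_le_sub _ (A0 k l)) _; apply: lerD => //.
  by apply: le_trans (hd k l) _; rewrite ge_min lexx.
apply: le_trans (mexp_lipschitz _ d0 hc1 hx1 hd b i j) _; first by rewrite lerDr.
by rewrite -ler_pdivlMr// ge_min lexx orbT.
Qed.

Definition cderive (f : R -> C) (t : R) (d : C) :=
  forall b, is_derive t 1 (fun x => part b (f x)) (part b d).

Definition mxderive m n (f : R -> 'M[C]_(m, n)) (t : R) (D : 'M[C]_(m, n)) :=
  forall i j, cderive (fun x => f x i j) t (D i j).

Lemma cderiveP f t d :
  cderive f t d <-> ccvg (0 : R)^' (fun h : R => (h^-1)%:C * (f (h + t) - f t)) d.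
Proof.
have E b : (fun h : R => h^-1 *: ((fun x => part b (f x)) (h *: 1 + t) - part b (f t)))
    = fun h : R => part b ((h^-1)%:C * (f (h + t) - f t)).
  by apply/funext => h; rewrite partZ partB [h *: 1]mulr1.
split=> h b.
  have [/= h1 h2] := h b; rewrite -h2 -E; exact: h1.
have := h b; rewrite -E => hb; split; first by apply/cvg_ex; eexists; exact: hb.
exact: cvg_lim hb.
Qed.

Lemma mxderive_cvg m n (f : R -> 'M[C]_(m, n)) t D : mxderive f t D ->
  mxcvg (0 : R)^' (fun h : R => (h^-1)%:C *: (f (h + t) - f t)) D.
Proof.
move=> h i j; have /cderiveP := h i j.
by under [X in _ -> ccvg _ X _]eq_fun do rewrite !mxE.
Qed.

Lemma cvg_mxderive m n (f : R -> 'M[C]_(m, n)) t D :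
  mxcvg (0 : R)^' (fun h : R => (h^-1)%:C *: (f (h + t) - f t)) D -> mxderive f t D.
Proof.
move=> h i j; apply/cderiveP; have := h i j.
by under [X in ccvg _ X _ -> _]eq_fun do rewrite !mxE.
Qed.

Lemma mxderive_continuous m n (f : R -> 'M[C]_(m, n)) t D : mxderive f t D ->
  mxcvg (0 : R)^' (fun h : R => f (h + t)) (f t).
Proof.
move=> /mxderive_cvg hf.
have -> : (fun h : R => f (h + t)) =
    fun h => f t + h%:C%:M *m ((h^-1)%:C *: (f (h + t) - f t)).
  apply/funext => h; rewrite mul_scalar_mx scalerA -rmorphM/=.
  have [->|h0] := eqVneq h 0; last by rewrite divff// scale1r [RHS]addrC subrK.
  by rewrite mul0r scale0r addr0 add0r.
rewrite -[X in mxcvg _ _ X]addr0 -[X in _ + X](mul0mx _ D).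
apply: mxcvgD; first exact: mxcvg_cst.
apply: mxcvgM hf => i j b; rewrite !mxE part0.
under eq_fun do rewrite mxE.
have -> : (fun h : R => part b (h%:C *+ (i == j))) = fun h => h * part b ((i == j)%:R).
  by apply/funext => h; rewrite -partZ mulr_natr.
set c := part b _.
suff : h * c @[h --> (0 : R)^'] --> 0 * c by rewrite mul0r.
apply: cvgM; last exact: cvg_cst.
by apply: cvg_within_filter; exact: cvg_id.
Qed.

(** By [mexp_block] the difference quotient is a block of [mexp] at a convergent block matrix, so
    continuity of [mexp] gives its limit. *)
Lemma mxderive_mexp n (A : R -> 'M[C]_n) t D : mxderive A t D ->
  mxderive (fun x => mexp (A x)) t (ursubmx (mexp (block_mx (A t) D 0 (A t)))).
Proof.
move=> hA; apply: cvg_mxderive.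
under eq_fun do rewrite -mexp_block.
suff h : mxcvg (0 : R)^' (fun h : R => block_mx (A (h + t)) ((h^-1)%:C *: (A (h + t) - A t))
    0 (A t)) (block_mx (A t) D 0 (A t)).
  exact: mxcvg_ursubmx (mxcvg_mexp h).
move=> i j; case: (split_ordP i) => k ->; case: (split_ordP j) => l ->.
- rewrite block_mxEul; under eq_fun do rewrite block_mxEul.
  exact: mxderive_continuous hA k l.
- rewrite block_mxEur; under eq_fun do rewrite block_mxEur.
  exact: mxderive_cvg hA k l.
- rewrite block_mxEdl; under eq_fun do rewrite block_mxEdl.
  exact: ccvg_cst.
- rewrite block_mxEdr; under eq_fun do rewrite block_mxEdr.
  exact: ccvg_cst.
Qed.

Lemma smooth_part n (f : R -> 'M[C]_n) : smooth f <->
  forall b i j k t, derivable (derive1n k (fun x => part b (f x i j))) t 1.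
Proof.
split=> [h b i j k t|h i j k t]; last first.
  by split; [exact: (h true)|exact: (h false)].
by case: b; [exact: (h i j k t).1|exact: (h i j k t).2].
Qed.

Lemma velocity_part n (f : R -> 'M[C]_n) t i j b :
  part b (velocity f t i j) = derive1 (fun x => part b (f x i j)) t.
Proof. by case: b; rewrite mxE. Qed.

Lemma smooth_mxderive n (f : R -> 'M[C]_n) t :
  smooth f -> mxderive f t (velocity f t).
Proof.
move=> /smooth_part hf i j b; rewrite velocity_part derive1E.
by apply: derivableP; exact: (hf b i j 0%N t).
Qed.

Lemma smooth_velocity n (f : R -> 'M[C]_n) : smooth f -> smooth (velocity f).
Proof.
move=> /smooth_part hf; apply/smooth_part => b i j k t.
under eq_fun do rewrite velocity_part.
by have := hf b i j k.+1 t; rewrite /derive1n iterSr.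
Qed.

(** The value is left existential because it is [c] for [k = 0] and 0 afterwards. *)
Lemma derive1n_cst k (c : R) : exists d : R, derive1n k (fun=> c : R) = fun=> d.
Proof.
elim: k c => [|k IH] c; first by exists c.
have [d hd] := IH 0; exists d; rewrite -hd /derive1n iterSr; congr iter.
by apply/funext => x; rewrite derive1_cst.
Qed.

Lemma smooth_block n (A D B : R -> 'M[C]_n) : smooth A -> smooth D -> smooth B ->
  smooth (fun t => block_mx (A t) (D t) 0 (B t)).
Proof.
move=> /smooth_part hA /smooth_part hD /smooth_part hB.
apply/smooth_part => b i j.
case: (split_ordP i) => k ->; case: (split_ordP j) => l -> m t.
- by under eq_fun do rewrite block_mxEul; exact: hA.
- by under eq_fun do rewrite block_mxEur; exact: hD.
- under eq_fun do rewrite block_mxEdl mxE part0.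
  have [d ->] := derive1n_cst m 0; exact: derivable_cst.
- by under eq_fun do rewrite block_mxEdr; exact: hB.
Qed.

(* By [mxderive_mexp] the derivative of [mexp] along a smooth curve is a block
   of [mexp] along a smooth curve of twice the size, whence the induction. *)
Lemma smooth_mexp n (A : R -> 'M[C]_n) : smooth A -> smooth (fun t => mexp (A t)).
Proof.
move=> hA; apply/smooth_part => b i j k.
elim: k n A hA i j => [|k IH] n A hA i j t.
  by have [] := mxderive_mexp (smooth_mxderive t hA) i j b.
rewrite /derive1n iterSr -/(derive1n k _).
have -> : derive1 (fun x => part b (mexp (A x) i j)) =
    fun x => part b (mexp (block_mx (A x) (velocity A x) 0 (A x))
      (lshift n i) (rshift n j)).
  apply/funext => x; rewrite derive1E.
  have [_ ->] := mxderive_mexp (smooth_mxderive x hA) i j b.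
  by rewrite ursubmx_entry.
exact: (IH _ _ (smooth_block hA (smooth_velocity hA) hA)).
Qed.

End ExpDerivative.

(** * The exponential of hermitian matrices is a contraction *)

Section ExpContraction.
Local Open Scope complex_scope.
Local Open Scope sesquilinear_scope.
Context {R : realType}.
Local Notation C := R[i].
Local Notation normc := Normc.normc.

Lemma hermitian_diagonalization n (A : 'M[C]_n) : A \is hermsymmx ->
  exists (V : 'M[C]_n) (mu : 'I_n -> R), V \is unitarymx /\
    A = V^t* *m diag_mx (\row_j (mu j)%:C) *m V.
Proof.
move=> hA; exists (spectralmx A), (fun j => complex.Re (spectral_diag A 0 j)).
split; first exact: spectral_unitarymx.
rewrite -invmx_unitary ?spectral_unitarymx//.
have -> : \row_j (complex.Re (spectral_diag A 0 j))%:C = spectral_diag A.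
  apply/rowP => j; rewrite mxE RRe_real//.
  by have /mxOverP := hermitian_spectral_diag_real hA; apply.
exact/orthomx_spectralP/hermitian_normalmx.
Qed.

Lemma mexp_spectral n (V : 'M[C]_n) (mu : 'I_n -> R) : V \is unitarymx ->
  mexp ('i%C *: (V^t* *m diag_mx (\row_j (mu j)%:C) *m V)) =
  V^t* *m diag_mx (\row_j cis (mu j)) *m V.
Proof.
move=> Vu; rewrite scalemxAl scalemxAr.
have -> : 'i%C *: diag_mx (\row_j (mu j)%:C) =
    diag_mx (\row_j ('i%C * (mu j)%:C)) :> 'M[C]_n.
  apply/matrixP => i j; rewrite !mxE; case: (i == j); last by rewrite mulr0.
  by rewrite !mulr1n.
by rewrite (mexp_conj _ (unitarymxP Vu)) mexp_diag.
Qed.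

Lemma normc_cis (x : R) : normc (cis x) = 1.
Proof. by rewrite /= cos2Dsin2 sqrtr1. Qed.

Lemma unitary_spectral n (V : 'M[C]_n) (d : 'rV[C]_n) : V \is unitarymx ->
  (forall j, normc (d 0 j) = 1) -> V^t* *m diag_mx d *m V \is unitarymx.
Proof.
move=> Vu hd; apply: mul_unitarymx (Vu); apply: mul_unitarymx.
  by rewrite trmxC_unitary.
apply/unitarymxP; apply/matrixP => i j; rewrite mul_diag_mx !mxE eq_sym.
have [->|_] := eqVneq i j; last by rewrite rmorph0 mulr0.
by rewrite -normCK normC_normc hd expr1n.
Qed.

Lemma mexp_hermitian_unitary n (A : 'M[C]_n) :
  A \is hermsymmx -> mexp ('i%C *: A) \is unitarymx.
Proof.
move=> /hermitian_diagonalization [V [mu [Vu ->]]].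
rewrite (mexp_spectral mu Vu).
by apply: unitary_spectral Vu _ => j; rewrite mxE normc_cis.
Qed.

Lemma lipschitz_of_derive (f f' : R -> R) (M x : R) :
  (forall z : R, is_derive z (1 : R) f (f' z)) -> (forall z, `|z| <= `|x| -> `|f' z| <= M) ->
  `|f x - f 0| <= M * `|x|.
Proof.
move=> df hM; have cf : continuous f.
  move=> z; apply/differentiable_continuous/derivable1_diffP.
  by have [] := df z.
have [x0|x0] := leP 0 x.
  have [c + ->] := @MVT_segment _ f f' 0 x x0 (fun z _ => df z)
    (continuous_subspaceT cf).
  rewrite in_itv/= => /andP[c0 cx].
  by rewrite subr0 normrM ler_wpM2r// hM// (ger0_norm c0) (ger0_norm x0).
have [c + E] := @MVT_segment _ f f' x 0 (ltW x0) (fun z _ => df z)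
  (continuous_subspaceT cf).
rewrite in_itv/= => /andP[xc c0].
rewrite distrC E sub0r normrM normrN ler_wpM2r// hM//.
by rewrite (ler0_norm c0) (ltr0_norm x0) lerN2.
Qed.

(** The mean value bound is used twice: first for |sin z| and |cos z - 1| against |z|, then with
    these as bounds on derivatives. The factor 2 comes from adding the real and imaginary parts. *)
Lemma normc_cis_taylor (x : R) : normc (cis x - 1 - 'i%C * x%:C) <= 2 * x ^+ 2.
Proof.
have dsin (z : R) : is_derive z (1 : R) (@sin R) (cos z) by exact: is_derive_sin.
have dcos (z : R) : is_derive z (1 : R) (@cos R) (- sin z) by exact: is_derive_cos.
have sin_le (z : R) : `|sin z| <= `|z|.
  have := @lipschitz_of_derive _ _ 1 z dsin; rewrite sin0 subr0 mul1r.
  by apply=> w _; rewrite ler_norml cos_geN1 cos_le1.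
have cos_le (z : R) : `|cos z - 1| <= `|z|.
  have := @lipschitz_of_derive _ _ 1 z dcos; rewrite cos0 mul1r.
  by apply=> w _; rewrite normrN ler_norml sin_geN1 sin_le1.
have h1 : `|cos x - 1| <= `|x| * `|x|.
  have := @lipschitz_of_derive _ _ `|x| x dcos; rewrite cos0.
  by apply=> w wx; rewrite normrN (le_trans (sin_le w)).
have h2 : `|sin x - x| <= `|x| * `|x|.
  have d (z : R) : is_derive z (1 : R) (fun y => sin y - y) (cos z - 1).
    by apply: is_deriveB.
  have := @lipschitz_of_derive _ _ `|x| x d; rewrite sin0 subr0 subr0.
  by apply=> w wx; rewrite (le_trans (cos_le w)).
apply: normc_le_part => -[]; rewrite /cis /=.
  by rewrite !(mul0r, mul1r, subr0, sub0r, oppr0, addr0) -real_normK ?num_real.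
by rewrite !(mul0r, mul1r, subr0, sub0r, oppr0, addr0, add0r, mulr0) -real_normK ?num_real.
Qed.

Lemma expmx_unitary n (U : 'M[C]_n) k : U \is unitarymx -> U ^+ k \is unitarymx.
Proof.
move=> Uu; elim: k => [|k IH]; last by rewrite expmxS; exact: mul_unitarymx Uu IH.
by rewrite expr0; apply/unitarymxP; rewrite trmx1 map_mx1 mulmx1.
Qed.

(** The difference of powers telescopes, and every term is [U - W] between unitary factors, which do
    not increase the trace norm. *)
Lemma trace_norm_expB n (U W : 'M[C]_n) k : U \is unitarymx -> W \is unitarymx ->
  trace_norm (U ^+ k - W ^+ k) <= k%:R * trace_norm (U - W).
Proof.
move=> Uu Wu.
have one_u : (1%:M : 'M[C]_n) \is unitarymx.
  by apply/unitarymxP; rewrite trmx1 map_mx1 mulmx1.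
elim: k => [|k IH]; first by rewrite !expr0 subrr mul0r trace_norm0.
have -> : U ^+ k.+1 - W ^+ k.+1 =
    U *m (U ^+ k - W ^+ k) *m 1%:M + 1%:M *m (U - W) *m W ^+ k.
  by rewrite !expmxS mulmx1 mul1mx mulmxBr mulmxBl addrA subrK.
rewrite -natr1 mulrDl mul1r; apply: le_trans (trace_normD _ _) _; apply: lerD.
  apply: le_trans IH.
  exact: trace_norm_contraction (contraction_unitary Uu) (contraction_unitary one_u).
exact: trace_norm_contraction (contraction_unitary one_u)
  (contraction_unitary (expmx_unitary k Wu)).
Qed.

Lemma cisX (x : R) m : cis x ^+ m = cis (m%:R * x).
Proof.
elim: m => [|m IH]; first by rewrite expr0 mul0r /cis cos0 sin0.
rewrite exprS IH -natr1 mulrDl mul1r /cis cosD sinD; simpc.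
by congr (_ +i* _); ring.
Qed.

(** [U] is the exponential of iA/k, built on the eigenvalues of [A]. The constant [c] does not
    depend on [k], so [k] such steps accumulate an error of order 1/k only. *)
Lemma exp_hermitian_step n (A : 'M[C]_n) : A \is hermsymmx ->
  exists2 c, 0 <= c & forall k : nat, (0 < k)%N ->
    exists U : 'M[C]_n, [/\ U \is unitarymx, U ^+ k = mexp ('i%C *: A) &
      trace_norm (U - 1%:M - ('i%C * (k%:R^-1)%:C) *: A) <= c / k%:R ^+ 2].
Proof.
move=> /hermitian_diagonalization [V [mu [Vu AE]]].
exists (\sum_j 2 * mu j ^+ 2) => [|k k0].
  by apply: sumr_ge0 => j _; rewrite mulr_ge0// sqr_ge0.
pose d : 'rV[C]_n := \row_j cis (k%:R^-1 * mu j).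
have VV := unitarymxKt Vu.
exists (V^t* *m diag_mx d *m V); split.
- by apply: unitary_spectral Vu _ => j; rewrite mxE normc_cis.
- rewrite AE (mexp_spectral mu Vu).
  suff -> : \row_j cis (mu j) = \row_j d 0 j ^+ k.
    by rewrite -diag_mx_exp; exact: (expmx_conj (diag_mx d) k (unitarymxP Vu)).
  apply/rowP => j; rewrite !mxE cisX mulrA divff ?mul1r//.
  by rewrite pnatr_eq0 -lt0n.
have -> : V^t* *m diag_mx d *m V - 1%:M - ('i%C * (k%:R^-1)%:C) *: A =
    V^t* *m diag_mx (\row_j (cis (k%:R^-1 * mu j) - 1 -
       'i%C * (k%:R^-1 * mu j)%:C)) *m V.
  rewrite AE -VV scalemxAl scalemxAr.
  have G (D E : 'M[C]_n) : V^t* *m D *m V - V^t* *m V - V^t* *m E *m V =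
      V^t* *m (D - 1%:M - E) *m V by rewrite !mulmxBr !mulmxBl mulmx1.
  rewrite G; apply: (congr1 (fun M => V^t* *m M *m V)).
  apply/matrixP => i j; rewrite !mxE; case: (i == j).
    by rewrite !mulr1n rmorphM mulrA.
  by rewrite !mulr0n mulr0 !subr0.
apply: le_trans (trace_norm_spectral _ Vu) _.
rewrite mulr_suml ler_sum// => j _; rewrite mxE.
apply: le_trans (normc_cis_taylor _) _.
by rewrite exprMn exprVn -mulrA [X in 2 * X]mulrC mulrA.
Qed.

Lemma trace_norm_mexpB n (A B : 'M[C]_n) : A \is hermsymmx -> B \is hermsymmx ->
  trace_norm (mexp ('i%C *: A) - mexp ('i%C *: B)) <= trace_norm (A - B).
Proof.
move=> /exp_hermitian_step [a a0 hA] /exp_hermitian_step [b b0 hB].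
apply/ler_addgt0Pr => e e0.
(* The remainders of the [k.+1] steps add up to at most (a + b) / (k + 1), which this choice makes
   at most [e]. *)
have [k] : exists k : nat, (a + b) / e <= k.+1%:R.
  exists (Num.truncn ((a + b) / e)); apply/ltW.
  have /andP[_] := truncn_itv (divr_ge0 (addr_ge0 a0 b0) (ltW e0)); exact.
rewrite ler_pdivrMr// => hk.
have [U [Uu <- hU]] := hA k.+1 isT; have [W [Wu <- hW]] := hB k.+1 isT.
apply: le_trans (trace_norm_expB _ Uu Wu) _.
have k0 : 0 < k.+1%:R :> R by rewrite ltr0n.
set s : C := 'i%C * _ in hU hW.
have hs : normc s = k.+1%:R^-1.
  rewrite Normc.normcM (_ : normc 'i%C = 1).
    by rewrite mul1r; apply: complexI; rewrite -normC_normc ger0_norm// ler0c.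
  by rewrite /= expr0n expr1n add0r sqrtr1.
have -> : U - W = (U - 1%:M - s *: A) - (W - 1%:M - s *: B) + s *: (A - B).
  by rewrite scalerBr; apply/matrixP => i j; rewrite !mxE; ring.
rewrite -ler_pdivlMl//.
apply: le_trans (trace_normD _ _) _.
have h1 : trace_norm (s *: (A - B)) <= k.+1%:R^-1 * trace_norm (A - B).
  by rewrite trace_normZ hs.
rewrite -trace_normN in hW; have h2 := le_trans (trace_normD _ _) (lerD hU hW).
apply: le_trans (lerD h2 h1) _.
rewrite addrC mulrDr lerD2l -mulrDl ler_pdivrMr ?exprn_gt0//.
have -> : k.+1%:R^-1 * e * k.+1%:R ^+ 2 = k.+1%:R * e by field; rewrite gt_eqF.
exact: hk.
Qed.

Lemma cvg_trace_norm T (F : set_system T) {FF : Filter F} n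
    (f : T -> 'M[C]_n) L :
  mxcvg F f L -> trace_norm (f x) @[x --> F] --> trace_norm L.
Proof.
move=> hf; apply/cvgrPdist_le => e e0.
(* The successor keeps the denominator positive when [n = 0]. *)
have e1 : 0 < e / (n * n).+1%:R by rewrite divr_gt0.
apply: filterS (mxcvg_near hf e1) => x hx.
apply: le_trans (trace_norm_lipschitz _ _) _.
apply: le_trans (trace_norm_le_entries _) _.
apply: (@le_trans _ _ (\sum_(i < n) \sum_(j < n) e / (n * n).+1%:R)).
  by apply: ler_sum => i _; apply: ler_sum => j _; rewrite !mxE ltW.
rewrite !sumr_const !card_ord -mulrnA -[leLHS]mulr_natl mulrCA ler_piMr ?ltW//.
by rewrite ltr_pdivrMr// mul1r ltr_nat.
Qed.

Lemma near_dnbhs_shift (P : R -> Prop) (t : R) :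
  (\forall x \near t, P x) -> \forall h \near (0 : R)^', P (h + t).
Proof.
move=> hP; have ct : (fun h : R => h + t) @ (0 : R) --> t.
  by rewrite -[X in _ --> X]add0r; apply: cvgD; [exact: cvg_id|exact: cvg_cst].
exact: nbhs_dnbhs (ct _ hP).
Qed.

Lemma trace_norm_limit (T : topologicalType) (F : set_system T) {FF : ProperFilter F} n
    (f g : T -> 'M[C]_n) A B :
  mxcvg F f A -> mxcvg F g B ->
  (\forall x \near F, trace_norm (f x) <= trace_norm (g x)) ->
  trace_norm A <= trace_norm B.
Proof.
move=> /cvg_trace_norm hf /cvg_trace_norm hg hfg.
exact: ler_cvg_to hf hg hfg.
Qed.

(** The inequality between chords, divided by the increment, passes to the limit. The relation
    between [E] and [X] is only local because smooth extensions follow the curves on [0, 1]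
    alone. *)
Lemma trace_norm_derive_exp n (X E : R -> 'M[C]_n) (t : R) D G :
  (\forall x \near t, X x \is hermsymmx /\ E x = mexp ('i%C *: X x)) ->
  mxderive X t D -> mxderive E t G -> trace_norm G <= trace_norm D.
Proof.
move=> hX /mxderive_cvg hD /mxderive_cvg hG; apply: trace_norm_limit hG hD _.
have [Xt Et] := nbhs_singleton hX.
apply: filterS (near_dnbhs_shift hX) => h [Xh Eh].
rewrite Eh Et (trace_normZ _ (mexp _ - _)) (trace_normZ _ (X _ - _)).
apply: ler_wpM2l; first exact: normc_ge0.
exact: (trace_norm_mexpB Xh Xt).
Qed.

End ExpContraction.

(** * Traces of polynomials along curves *)

Section TraceCalculus.
Local Open Scope complex_scope.
Local Open Scope sesquilinear_scope.
Context {R : realType}.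
Local Notation C := R[i].
Local Notation normc := Normc.normc.

Lemma mxderive_cst m n (L : 'M[C]_(m, n)) (t : R) : mxderive (fun=> L) t 0.
Proof.
apply: cvg_mxderive.
under eq_fun do rewrite subrr scaler0.
exact: mxcvg_cst.
Qed.

Lemma mxderiveD m n (f g : R -> 'M[C]_(m, n)) t D E :
  mxderive f t D -> mxderive g t E -> mxderive (fun x => f x + g x) t (D + E).
Proof.
move=> /mxderive_cvg hf /mxderive_cvg hg; apply: cvg_mxderive.
under eq_fun do rewrite opprD addrACA scalerDr.
exact: mxcvgD.
Qed.

Lemma mxderiveZ m n (c : C) (f : R -> 'M[C]_(m, n)) t D :
  mxderive f t D -> mxderive (fun x => c *: f x) t (c *: D).
Proof.
move=> /mxderive_cvg hf; apply: cvg_mxderive.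
under eq_fun do rewrite -scalerBr scalerA mulrC -scalerA.
exact: mxcvgZ.
Qed.

Lemma mxderiveM m n p (f : R -> 'M[C]_(m, n)) (g : R -> 'M[C]_(n, p)) t D E :
  mxderive f t D -> mxderive g t E ->
  mxderive (fun x => f x *m g x) t (D *m g t + f t *m E).
Proof.
move=> /mxderive_cvg hf hg; apply: cvg_mxderive.
have -> : (fun h : R => (h^-1)%:C *: (f (h + t) *m g (h + t) - f t *m g t)) =
    fun h : R => ((h^-1)%:C *: (f (h + t) - f t)) *m g (h + t) +
      f t *m ((h^-1)%:C *: (g (h + t) - g t)).
  apply/funext => h; rewrite -scalemxAl -scalemxAr -scalerDr mulmxBl mulmxBr.
  by rewrite addrA subrK.
apply: mxcvgD; first by apply: mxcvgM hf _; exact: mxderive_continuous hg.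
by apply: mxcvgM; [exact: mxcvg_cst|exact: mxderive_cvg].
Qed.

Lemma mxderive_sum m n I (r : seq I) (f : I -> R -> 'M[C]_(m, n)) t D :
  (forall i, mxderive (f i) t (D i)) ->
  mxderive (fun x => \sum_(i <- r) f i x) t (\sum_(i <- r) D i).
Proof.
move=> h; elim: r => [|i r IH].
  rewrite big_nil; under eq_fun do rewrite big_nil; exact: mxderive_cst.
rewrite big_cons; under eq_fun do rewrite big_cons; exact: mxderiveD.
Qed.

Lemma part_conj b (z : C) : part b (Num.conj z) = (if b then 1 else -1) * part b z.
Proof. by case: b z => -[x y] /=; rewrite ?mul1r ?mulN1r. Qed.

Lemma mxderive_trC m n (f : R -> 'M[C]_(m, n)) t D :
  mxderive f t D -> mxderive (fun x => (f x)^t*) t (D^t*).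
Proof.
move=> hf i j b; rewrite !mxE part_conj.
under eq_fun do rewrite !mxE part_conj.
exact: is_deriveZ (hf j i b).
Qed.

Lemma cderive_mxtrace n (f : R -> 'M[C]_n) t D :
  mxderive f t D -> cderive (fun x => \tr (f x)) t (\tr D).
Proof.
move=> /mxderive_cvg hf; apply/cderiveP.
under [X in ccvg _ X _]eq_fun do rewrite -linearB /= -mxtraceZ.
by apply: ccvg_sum => i; exact: hf.
Qed.

Lemma mxderive_unique m n (f : R -> 'M[C]_(m, n)) t D E :
  mxderive f t D -> mxderive f t E -> D = E.
Proof. by move=> /mxderive_cvg hD /mxderive_cvg hE; exact: mxcvg_unique hD hE. Qed.

(** [E] is the sum of the products [A t ^+ i *m D *m A t ^+ j] with i + j = k - 1. Against a matrix
    commuting with [A t], cyclicity of the trace merges them; the induction needs a general [M], as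
    it passes from [M] to [M *m A t]. *)
Lemma mxderiveX n (A : R -> 'M[C]_n) t D k : mxderive A t D ->
  exists2 E, mxderive (fun x => A x ^+ k) t E &
    forall M, M *m A t = A t *m M ->
      \tr (M *m E) = k%:R * \tr (M *m A t ^+ k.-1 *m D).
Proof.
move=> hA; elim: k => [|k [E hE trE]].
  exists 0; first by under eq_fun do rewrite expr0; exact: mxderive_cst.
  by move=> M _; rewrite mulmx0 mxtrace0 mul0r.
exists (D *m A t ^+ k + A t *m E).
  by under eq_fun do rewrite expmxS; exact: mxderiveM.
move=> M MA; rewrite mulmxDr mxtraceD.
have MAk l : M *m A t ^+ l = A t ^+ l *m M.
  elim: l => [|l IH]; first by rewrite !expr0 mulmx1 mul1mx.
  by rewrite expmxS mulmxA MA -mulmxA IH mulmxA.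
have -> : \tr (M *m (D *m A t ^+ k)) = \tr (M *m A t ^+ k *m D).
  by rewrite mulmxA mxtrace_mulC mulmxA MAk.
have MMA : M *m A t *m A t = A t *m (M *m A t) by rewrite mulmxA MA.
rewrite mulmxA (trE _ MMA) /=.
case: k {hE trE} => [|k]; first by rewrite mul0r addr0 mul1r.
by rewrite -(mulmxA M (A t)) -expmxS -[in RHS]natr1 mulrDl mul1r addrC.
Qed.

Definition pmx n (q : {poly R}) (A : 'M[C]_n) : 'M[C]_n :=
  \sum_(i < size q) (q`_i)%:C *: A ^+ i.

Lemma pmx_wide n (q : {poly R}) (A : 'M[C]_n) N : (size q <= N)%N ->
  pmx q A = \sum_(i < N) (q`_i)%:C *: A ^+ i.
Proof.
move=> hN; rewrite /pmx (big_ord_widen N (fun i => (q`_i)%:C *: A ^+ i))//.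
rewrite big_mkcond; apply: eq_bigr => i _; case: ltnP => // hi.
by rewrite nth_default// scale0r.
Qed.

(** Under the trace the scalar chain rule survives even when [A t] and [D] do not commute. *)
Lemma cderive_pmx n (q : {poly R}) (A : R -> 'M[C]_n) t D : mxderive A t D ->
  cderive (fun x => \tr (pmx q (A x))) t (\tr (pmx q^`() (A t) *m D)).
Proof.
move=> hA.
have [E hE] : exists E : nat -> 'M[C]_n, forall k,
    mxderive (fun x => A x ^+ k) t (E k) /\
    \tr (E k) = k%:R * \tr (A t ^+ k.-1 *m D).
  suff /choice[E hE] : forall k : nat, exists E : 'M[C]_n,
    mxderive (fun x => A x ^+ k) t E /\ \tr E = k%:R * \tr (A t ^+ k.-1 *m D).
    by exists E.
  move=> k; have [E h1 h2] := mxderiveX k hA; exists E; split=> //.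
  by have := h2 1%:M; rewrite mulmx1 !mul1mx => ->.
suff <- : \tr (\sum_(i < size q) (q`_i)%:C *: E i) = \tr (pmx q^`() (A t) *m D).
  apply: cderive_mxtrace; apply: mxderive_sum => i; apply: mxderiveZ.
  by have [] := hE i.
have [->|q0] := eqVneq q 0.
  by rewrite deriv0 /pmx !size_poly0 !big_ord0 mul0mx.
have sq : size q = (size q).-1.+1 by rewrite prednK// size_poly_gt0.
rewrite (@pmx_wide _ _ _ (size q).-1); last first.
  by rewrite -ltnS -sq lt_size_deriv.
rewrite sq big_ord_recl mxtraceD mxtraceZ.
have [_ ->] := hE 0%N; rewrite mul0r mulr0 add0r.
rewrite mulmx_suml !raddf_sum; apply: eq_bigr => i _.
rewrite -scalemxAl /= !mxtraceZ coef_deriv.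
have [_ ->] := hE (bump 0 i); rewrite /bump/= add1n.
by rewrite mulrA mulr_natr rmorphMn.
Qed.

Lemma pmx_spectral n (q : {poly R}) (V : 'M[C]_n) (x : 'I_n -> R) :
  V \is unitarymx ->
  pmx q (V^t* *m diag_mx (\row_j (x j)%:C) *m V) =
  V^t* *m diag_mx (\row_j (q.[x j])%:C) *m V.
Proof.
move=> Vu; rewrite /pmx.
transitivity (V^t* *m (\sum_(i < size q) (q`_i)%:C *:
    diag_mx (\row_j (x j)%:C) ^+ i) *m V).
  rewrite mulmx_sumr mulmx_suml; apply: eq_bigr => i _.
  by rewrite (expmx_conj _ _ (unitarymxP Vu)) -scalemxAr -scalemxAl.
apply: (congr1 (fun M => V^t* *m M *m V)); apply/matrixP => i j; rewrite summxE !mxE horner_coef.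
under eq_bigr do rewrite diag_mx_exp !mxE.
case: (i == j); last by rewrite mulr0n big1// => k _; rewrite mulr0n mulr0.
by rewrite mulr1n rmorph_sum; apply: eq_bigr => k _;
  rewrite mulr1n rmorphM rmorphXn.
Qed.

(** For unitary [U] with eigenvalues e^{ia} this is hermitian with eigenvalues cos a. It is
    real-linear in [U], so the same formula serves for velocities. *)
Definition cosmx n (U : 'M[C]_n) : 'M[C]_n := 2^-1 *: (U + U^t*).

Lemma cosmx_spectral n (V : 'M[C]_n) (l : 'rV[C]_n) :
  cosmx (V^t* *m diag_mx l *m V) =
  V^t* *m diag_mx (\row_j (complex.Re (l 0 j))%:C) *m V.
Proof.
rewrite /cosmx !trmx_mul !map_mxM trmxCK tr_diag_mx map_diag_mx mulmxA.
rewrite -mulmxDl -mulmxDr scalemxAl scalemxAr.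
apply: (congr1 (fun M => V^t* *m M *m V)).
apply/matrixP => i j; rewrite !mxE; case: (i == j).
  rewrite !mulr1n ReJ_add mulrC; congr (_ / _).
by rewrite !mulr0n addr0 mulr0.
Qed.

Lemma unitary_diagonalization n (U : 'M[C]_n) : U \is unitarymx ->
  exists (V : 'M[C]_n) (l : 'rV[C]_n), [/\ V \is unitarymx,
    U = V^t* *m diag_mx l *m V & forall j, `|l 0 j| = 1].
Proof.
move=> Uu; exists (spectralmx U), (spectral_diag U).
have Vu := spectral_unitarymx U; set V := spectralmx U in Vu *.
have UE : U = V^t* *m diag_mx (spectral_diag U) *m V.
  rewrite -invmx_unitary//; apply/orthomx_spectralP/normalmxP.
  by rewrite (unitarymxP Uu) unitarymxKt.
split=> // j.
have : V *m U *m (V *m U)^t* = 1%:M.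
  rewrite trmx_mul map_mxM mulmxA -(mulmxA V) (unitarymxP Uu) mulmx1.
  exact: unitarymxP.
rewrite {1 2}UE !mulmxA (unitarymxP Vu) mul1mx trmx_mul map_mxM mulmxA.
rewrite -(mulmxA (diag_mx _) V) (unitarymxP Vu) mulmx1.
move=> /matrixP/(_ j j); rewrite mul_diag_mx !mxE eqxx !mulr1n -normCK => h.
by apply/eqP; rewrite -(@eqrXn2 _ 2)// ?ler01// expr1n h.
Qed.

End TraceCalculus.

(** * The energy of a unitary matrix and its rate of change along curves *)

Section Energy.
Local Open Scope complex_scope.
Local Open Scope sesquilinear_scope.
Context {R : realType} (q : {poly R}).
Local Notation C := R[i].
Local Notation normc := Normc.normc.
Local Notation mu := lebesgue_measure.

(* If the eigenvalues of U are the e^{i a_j}, this is - \sum_j q(cos a_j). *)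
Definition energy n (U : 'M[C]_n) : R := - complex.Re (\tr (pmx q (cosmx U))).

Definition denergy n (U G : 'M[C]_n) : R :=
  - complex.Re (\tr (pmx q^`() (cosmx U) *m cosmx G)).

Lemma is_derive_energy n (g : R -> 'M[C]_n) t G : mxderive g t G ->
  is_derive t (1 : R) (fun x => energy (g x)) (denergy (g t) G).
Proof.
move=> hg; apply: is_deriveN.
have hc : mxderive (fun x => cosmx (g x)) t (cosmx G).
  by apply: mxderiveZ; apply: mxderiveD hg (mxderive_trC hg).
exact: (cderive_pmx q hc true).
Qed.

(** Differentiate [g x *m (g x)^t* = 1%:M] at [t]. *)
Lemma unitary_tangent n (g : R -> 'M[C]_n) t G : mxderive g t G ->
  (\forall x \near t, g x \is unitarymx) -> G *m (g t)^t* + g t *m G^t* = 0.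
Proof.
move=> hg hu; apply: mxderive_unique (mxderiveM hg (mxderive_trC hg)) _.
move=> i j b.
apply: near_eq_is_derive (mxderive_cst 1%:M t i j b).
by apply: filterS hu => x xu; rewrite (unitarymxP xu).
Qed.

Hypothesis q_slope : forall x : R, -1 <= x <= 1 -> q^`().[x] ^+ 2 * (1 - x ^+ 2) <= 1.

(** For l = a + ib of modulus 1, the conjugate c of l satisfies 1 - c^2 = c (l - c) = 2ibc. The
    factor therefore has modulus |q'(a) b| with b^2 = 1 - a^2, which [q_slope] bounds. *)
Lemma denergy_factor_le (l : C) : `|l| = 1 ->
  `| - 2^-1 * ((q^`().[complex.Re l])%:C * (1 - Num.conj l ^+ 2))| <= 1.
Proof.
case: l => a b nl.
have ab : a ^+ 2 + b ^+ 2 = 1.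
  by apply: complexI; have := add_Re2_Im2 (a +i* b); rewrite nl expr1n => h; exact: h.
set p := q^`().[_].
have -> : - 2^-1 * (p%:C * (1 - Num.conj (a +i* b) ^+ 2)) =
    - (p * b)%:C * 'i%C * Num.conj (a +i* b).
  set cl := Num.conj _; have ll : (a +i* b) * cl = 1 by rewrite -normCK nl expr1n.
  have -> : 1 - cl ^+ 2 = cl * ((a +i* b) - cl) by rewrite mulrBr [cl * _]mulrC ll.
  have -> : (a +i* b) - cl = 2%:R * b%:C * 'i%C by exact: subcJ.
  by rewrite rmorphM; field.
rewrite !normrM normrN norm_conjC nl mulr1 !normC_normc [X in _ * X%:C]/=.
rewrite expr0n expr1n add0r sqrtr1 mulr1 -normC_normc normc_def/= expr0n addr0.
rewrite sqrtr_sqr lecR -(@ler_pXn2r _ 2) ?nnegrE// real_normK ?num_real//.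
rewrite expr1n exprMn (_ : b ^+ 2 = 1 - a ^+ 2) ?q_slope//.
  have : a ^+ 2 <= 1 by rewrite -ab lerDl sqr_ge0.
  by rewrite -[X in _ <= X](expr1n _ 2) -ler_norml -real_normK ?num_real//
    ler_pXn2r ?nnegrE// ler_norml.
by rewrite -ab addrC addKr.
Qed.

Lemma denergy_le n (U G : 'M[C]_n) : U \is unitarymx ->
  G *m U^t* + U *m G^t* = 0 -> denergy U G <= trace_norm G.
Proof.
move=> Uu hG; have [V [l [Vu UE l1]]] := unitary_diagonalization Uu.
have UsE : U^t* = V^t* *m diag_mx (map_mx Num.conj l) *m V.
  by rewrite UE !trmx_mul !map_mxM trmxCK tr_diag_mx map_diag_mx mulmxA.
have GsE : G^t* = - (U^t* *m G *m U^t*).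
  have := congr1 (mulmx (U^t*)) hG; rewrite mulmxDr mulmx0 !mulmxA.
  by rewrite unitarymxKt// mul1mx => /eqP; rewrite addrC addr_eq0 => /eqP.
pose d : 'rV[C]_n := \row_j (- 2^-1 *
  ((q^`().[complex.Re (l 0 j)])%:C * (1 - Num.conj (l 0 j) ^+ 2))).
set P := pmx q^`() (cosmx U).
have PE : P = V^t* *m diag_mx (\row_j (q^`().[complex.Re (l 0 j)])%:C) *m V.
  by rewrite /P UE cosmx_spectral (pmx_spectral _ (fun j => complex.Re (l 0 j)) Vu).
have KE : - 2^-1 *: (P - U^t* *m P *m U^t*) = V^t* *m diag_mx d *m V.
  rewrite PE UsE.
  have -> (D E : 'M[C]_n) : V^t* *m D *m V *m (V^t* *m E *m V) *m
      (V^t* *m D *m V) = V^t* *m (D *m E *m D) *m V.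
    rewrite !mulmxA -(mulmxA _ V) (unitarymxP Vu) mulmx1.
    by rewrite -(mulmxA _ V) (unitarymxP Vu) mulmx1.
  rewrite -mulmxBl -mulmxBr scalemxAl scalemxAr !mulmx_diag.
  apply: (congr1 (fun M => V^t* *m M *m V)).
  apply/matrixP => i j; rewrite !mxE; case: (i == j); last first.
    by rewrite !mulr0n subr0 mulr0.
  by rewrite !mulr1n; ring.
have cyc (K L M : 'M[C]_n) : \tr (K *m (L *m M *m L)) = \tr (L *m K *m L *m M).
  by rewrite !mulmxA mxtrace_mulC !mulmxA.
have -> : denergy U G = complex.Re (\tr (V^t* *m diag_mx d *m V *m G)).
  have ReN (z : C) : - complex.Re z = complex.Re (- z) by case: z.
  rewrite -KE /denergy -/P ReN; congr complex.Re.
  rewrite /cosmx GsE -scalemxAr -scalemxAl !mxtraceZ mulNr; congr (- (_ * _)).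
  by rewrite mulmxBr mulmxBl [LHS]raddfB [RHS]raddfB /= cyc.
apply: Re_mxtrace_contraction; apply: contraction_spectral Vu _ => j.
by rewrite mxE; apply: denergy_factor_le.
Qed.

Lemma mxderive_cvg_nbhs m n (f : R -> 'M[C]_(m, n)) t D :
  mxderive f t D -> mxcvg (nbhs t) f (f t).
Proof.
move=> hf i j b; have [h _] := hf i j b.
by move/derivable1_diffP/differentiable_continuous in h; exact: h.
Qed.

Lemma smooth_continuous n (g : R -> 'M[C]_n) t : smooth g -> mxcvg (nbhs t) g (g t).
Proof. by move=> hg; exact: mxderive_cvg_nbhs (smooth_mxderive t hg). Qed.

Lemma mxcvg_trC T (F : set_system T) {FF : Filter F} m n
    (f : T -> 'M[C]_(m, n)) L :
  mxcvg F f L -> mxcvg F (fun x => (f x)^t*) (L^t*).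
Proof.
move=> hf i j b; rewrite !mxE part_conj.
under eq_fun do rewrite !mxE part_conj.
by apply: cvgM; [exact: cvg_cst|exact: hf].
Qed.

Lemma mxcvg_cosmx T (F : set_system T) {FF : Filter F} n (f : T -> 'M[C]_n) L :
  mxcvg F f L -> mxcvg F (fun x => cosmx (f x)) (cosmx L).
Proof. by move=> hf; apply: mxcvgZ; apply: mxcvgD hf (mxcvg_trC hf). Qed.

Lemma mxcvg_sum T (F : set_system T) {FF : Filter F} m n I (r : seq I)
    (f : I -> T -> 'M[C]_(m, n)) L : (forall i, mxcvg F (f i) (L i)) ->
  mxcvg F (fun x => \sum_(i <- r) f i x) (\sum_(i <- r) L i).
Proof.
move=> h; elim: r => [|i r IH].
  rewrite big_nil; under eq_fun do rewrite big_nil; exact: mxcvg_cst.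
rewrite big_cons; under eq_fun do rewrite big_cons; exact: mxcvgD.
Qed.

Lemma mxcvg_pmx T (F : set_system T) {FF : Filter F} n p (f : T -> 'M[C]_n) L :
  mxcvg F f L -> mxcvg F (fun x => pmx p (f x)) (pmx p L).
Proof.
move=> hf; apply: mxcvg_sum => i; apply: mxcvgZ.
elim: (i : nat) => [|k IH].
  rewrite expr0; under eq_fun do rewrite expr0; exact: mxcvg_cst.
rewrite expmxS; under eq_fun do rewrite expmxS; exact: mxcvgM.
Qed.

Lemma denergy_continuous n (g : R -> 'M[C]_n) : smooth g ->
  continuous (fun t => denergy (g t) (velocity g t)).
Proof.
move=> hg t; apply: cvgN.
have h : mxcvg (nbhs t) (fun x => pmx q^`() (cosmx (g x)) *m cosmx (velocity g x))
    (pmx q^`() (cosmx (g t)) *m cosmx (velocity g t)).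
  apply: mxcvgM.
    by apply: mxcvg_pmx; apply: mxcvg_cosmx; exact: smooth_continuous.
  by apply: mxcvg_cosmx; apply: smooth_continuous; exact: smooth_velocity.
have htr : ccvg (nbhs t)
    (fun x => \tr (pmx q^`() (cosmx (g x)) *m cosmx (velocity g x)))
    (\tr (pmx q^`() (cosmx (g t)) *m cosmx (velocity g t))).
  by apply: ccvg_sum => i; exact: h.
exact: (htr true).
Qed.

Lemma speed_continuous n (g : R -> 'M[C]_n) : smooth g ->
  continuous (fun t => trace_norm (velocity g t)).
Proof.
move=> hg t; apply: cvg_trace_norm; apply: smooth_continuous.
exact: smooth_velocity.
Qed.

End Energy.

(** * Energy differences as lower bounds for length *)

Section Length.
Local Open Scope complex_scope.
Local Open Scope sesquilinear_scope.
Context {R : realType}.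
Local Notation C := R[i].
Local Notation mu := (@lebesgue_measure R).

Lemma velocity_near n (f g : R -> 'M[C]_n) (t : R) :
  (\forall x \near t, f x = g x) -> velocity f t = velocity g t.
Proof.
move=> fg; apply/matrixP => i j; apply: part_inj => b.
rewrite !velocity_part !derive1E; apply: near_eq_derive.
by apply: filterS fg => x ->.
Qed.

Lemma near_itv_oo (a b t : R) : t \in `]a, b[ -> \forall x \near t, a <= x <= b.
Proof.
move=> /near_in_itvoo; apply: filterS => x.
by rewrite in_itv/= => /andP[/ltW -> /ltW ->].
Qed.

Lemma velocity_itv n (f g : R -> 'M[C]_n) (a b t : R) :
  (forall x, a <= x <= b -> f x = g x) -> t \in `]a, b[ ->
  velocity f t = velocity g t.
Proof.
move=> fg tab; apply: velocity_near.
by apply: filterS (near_itv_oo tab) => x; exact: fg.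
Qed.

(** The interval is open because at its ends the velocity of [f] may differ from that of the smooth
    extension. *)
Lemma measurable_speed n (f : R -> 'M[C]_n) (a b : R) : smooth_on a b f ->
  measurable_fun `]a, b[ (fun t => trace_norm (velocity f t)).
Proof.
move=> [g [sg fg]].
apply: (@eq_measurable_fun _ _ _ _ _ (fun t => trace_norm (velocity g t))).
  by move=> t; rewrite inE/= => tab; rewrite (velocity_itv fg).
apply: open_continuous_measurable_fun; first exact: interval_open.
by move=> t _; exact: speed_continuous.
Qed.

(** The fundamental theorem of calculus writes the energy gain as an integral of [denergy], which is
    at most the speed at interior points. The half-open interval lets consecutive pieces join
    disjointly. *)
Lemma energy_piece n (q : {poly R}) (f : R -> 'M[C]_n) (a b : R) :
  (forall x : R, -1 <= x <= 1 -> q^`().[x] ^+ 2 * (1 - x ^+ 2) <= 1) ->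
  a < b -> smooth_on a b f -> (forall t, a <= t <= b -> f t \is unitarymx) ->
  ((energy q (f b) - energy q (f a))%:E <=
   \int[mu]_(t in `[a, b[) (trace_norm (velocity f t))%:E)%E.
Proof.
move=> hq ab sf fu; have [g [sg fg]] := sf.
rewrite integral_itv_bndoo; last first.
  by apply/measurable_EFinP; exact: measurable_speed sf.
have -> : (\int[mu]_(t in `]a, b[) (trace_norm (velocity f t))%:E =
    \int[mu]_(t in `]a, b[) (trace_norm (velocity g t))%:E)%E.
  by apply: eq_integral => t; rewrite inE/= => tab; rewrite (velocity_itv fg).
have fga : f a = g a by apply: fg; rewrite lexx ltW.
have fgb : f b = g b by apply: fg; rewrite lexx ltW.
rewrite fga fgb; have dE t := is_derive_energy q (smooth_mxderive t sg).
have cE : continuous (fun x => energy q (g x)).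
  move=> t; have [/derivable1_diffP/differentiable_continuous h _] := dE t.
  exact: h.
have cD := denergy_continuous (q := q) sg.
rewrite EFinB -(@continuous_FTC2 _ (fun t => denergy q (g t) (velocity g t))
  (fun x => energy q (g x)) _ _ ab).
- rewrite (@integral_itv_bndoo _ a b (EFin \o _)); last first.
    apply/measurable_EFinP; apply: open_continuous_measurable_fun => [|t _].
      exact: interval_open.
    exact: cD.
  have int_of (h : R -> R) : continuous h -> mu.-integrable `]a, b[ (EFin \o h).
    move=> ch; have ci : mu.-integrable `[a, b] (EFin \o h).
      apply: continuous_compact_integrable; first exact: segment_compact.
      exact: continuous_subspaceT.
    apply: integrableS ci => //.
    by apply: subset_itv; rewrite bnd_simp.
  apply: le_integral => //; first exact: int_of cD.
    exact: int_of (speed_continuous sg).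
  move=> t; rewrite inE/= => tab; rewrite lee_fin.
  have gu : \forall x \near t, g x \is unitarymx.
    by apply: filterS (near_itv_oo tab) => x xab; rewrite -fg// fu.
  apply: denergy_le => //; first exact: nbhs_singleton gu.
  exact: unitary_tangent (smooth_mxderive t sg) gu.
- exact: continuous_subspaceT.
- split=> [t _||]; first by have [] := dE t.
    by apply: cvg_within_filter; exact: cE.
  by apply: cvg_within_filter; exact: cE.
- by move=> t _; rewrite derive1E; have [_ ->] := dE t.
Qed.

(** Induction on the partition. The order of the endpoints and measurability are carried along
    because splitting the integral at the next breakpoint requires them. *)
Lemma energy_path n (q : {poly R}) (f : R -> 'M[C]_n) (a b : R) (s : seq R) :
  (forall x : R, -1 <= x <= 1 -> q^`().[x] ^+ 2 * (1 - x ^+ 2) <= 1) ->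
  path <%R a s -> last a s = b ->
  (forall k, (k < size s)%N -> smooth_on (nth 0 (a :: s) k) (nth 0 s k) f) ->
  (forall t, a <= t <= b -> f t \is unitarymx) ->
  [/\ a <= b, measurable_fun `[a, b] (fun t => trace_norm (velocity f t)) &
  ((energy q (f b) - energy q (f a))%:E <=
   \int[mu]_(t in `[a, b]) (trace_norm (velocity f t))%:E)%E].
Proof.
move=> hq; elim: s a => [|c s IH] a /=.
  move=> _ -> _ _; split=> //.
    by rewrite set_itv1; exact: measurable_fun_set1.
  rewrite subrr; apply: integral_ge0 => t _; rewrite lee_fin; exact: trace_norm_ge0.
move=> /andP[ac cs] sb hs fu.
have hs' k : (k < size s)%N -> smooth_on (nth 0 (c :: s) k) (nth 0 s k) f.
  by move=> ks; have := hs k.+1; apply.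
have [|cb mcb lecb] := IH c cs sb hs'.
  by move=> t /andP[ct tb]; apply: fu; rewrite (le_trans (ltW ac) ct) tb.
have sac : smooth_on a c f by have := hs 0%N; apply.
have fac t : a <= t <= c -> f t \is unitarymx.
  by move=> /andP[at_ tc]; apply: fu; rewrite at_ (le_trans tc cb).
have leac := energy_piece hq ac sac fac.
have E : `[a, b]%classic = `[a, c[ `|` `[c, b].
  by apply: itv_bndbnd_setU; rewrite bnd_simp// ltW.
have mU : measurable_fun (`[a, c[ `|` `[c, b])
    (fun t => trace_norm (velocity f t)).
  apply/measurable_funU => //; split => //.
  by apply/measurable_fun_itv_obnd_cbndP; exact: measurable_speed sac.
split; first by rewrite (le_trans (ltW ac)).
  by rewrite E.
have dis : [disjoint `[a, c[%classic & `[c, b]%classic]%classic.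
  apply/disj_setPS => t []/=; rewrite !in_itv/= => /andP[_ tc] /andP[ct _].
  by move: (lt_le_trans tc ct); rewrite ltxx.
have mE : measurable_fun (`[a, c[ `|` `[c, b])
  (EFin \o (fun t => trace_norm (velocity f t))) by exact/measurable_EFinP.
have speed_ge0 t : (0 <= (trace_norm (velocity f t))%:E)%E.
  by rewrite lee_fin trace_norm_ge0.
have addE : (\int[mu]_(t in `[a, c[ `|` `[c, b]) (trace_norm (velocity f t))%:E =
    \int[mu]_(t in `[a, c[) (trace_norm (velocity f t))%:E +
    \int[mu]_(t in `[c, b]) (trace_norm (velocity f t))%:E)%E.
  apply: ge0_integral_setU; [exact: measurable_itv|exact: measurable_itv|
    exact: mE|by move=> t _; exact: speed_ge0|exact: dis].
rewrite E addE.
apply: le_trans _ (leeD leac lecb).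
by rewrite -EFinD lee_fin [leRHS]addrC addrA subrK.
Qed.

Lemma energy_length n (q : {poly R}) (f : R -> 'M[C]_n) :
  (forall x : R, -1 <= x <= 1 -> q^`().[x] ^+ 2 * (1 - x ^+ 2) <= 1) ->
  piecewise_smooth f -> lies_in unitary_set f ->
  ((energy q (f 1) - energy q (f 0))%:E <= curve_length f)%E.
Proof.
move=> hq [s [[hs /eqP hl] sf]] fu.
by have [] := energy_path hq hs hl sf fu.
Qed.

End Length.

(** * Polynomial approximation of the arccosine *)

Section Arccos.
Context {R : realType}.

(* Newton's iteration for the inverse square root of [1 - 'X^2]: on [-1, 1]
   it increases to [-arccos'] and stays below it. *)
Fixpoint invsqrt_poly (k : nat) : {poly R} :=
  if k is k'.+1 then
    invsqrt_poly k' * (3%:P - (1 - 'X^2) * invsqrt_poly k' ^+ 2) * (2^-1)%:P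
  else 1.

Lemma invsqrt_polyS k (x : R) (v := (invsqrt_poly k).[x]) :
  (invsqrt_poly k.+1).[x] = v * ((3 - v ^+ 2 * (1 - x ^+ 2)) / 2).
Proof.
rewrite /= -polyC1 !(hornerM, hornerD, hornerN, hornerX, horner_exp, hornerC).
by rewrite -/v; field.
Qed.

(** With [w = v ^+ 2 * (1 - x ^+ 2)], a Newton step replaces 1 - w by (1 - w)^2 (4 - w) / 4. So w
    stays at most 1, and the new defect is at most the square of the old one, which more than gains
    the extra factor [x ^+ 2]. *)
Lemma invsqrt_polyP k (x : R) : -1 <= x <= 1 ->
  let v := (invsqrt_poly k).[x] in
  [/\ 1 <= v, v ^+ 2 * (1 - x ^+ 2) <= 1 &
      1 - v ^+ 2 * (1 - x ^+ 2) <= (x ^+ 2) ^+ k.+1].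
Proof.
move=> x1; have x2 : x ^+ 2 <= 1 by nra.
elim: k => [|k [v1 w1 wk]].
  by rewrite /= !hornerE expr1n mul1r; split; nra.
move=> u; rewrite {}/u invsqrt_polyS; set v := (invsqrt_poly k).[x] in v1 w1 wk *.
set w := v ^+ 2 * (1 - x ^+ 2) in w1 wk *.
have w0 : 0 <= w by rewrite mulr_ge0 ?sqr_ge0// subr_ge0.
have E : (v * ((3 - w) / 2)) ^+ 2 * (1 - x ^+ 2) = w * ((3 - w) / 2) ^+ 2.
  by rewrite exprMn mulrAC.
have F : 1 - w * ((3 - w) / 2) ^+ 2 = (1 - w) ^+ 2 * ((4 - w) / 4) by field.
rewrite E; split.
- by nra.
- by rewrite -subr_ge0 F mulr_ge0 ?sqr_ge0//; lra.
rewrite F.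
apply: (@le_trans _ _ ((1 - w) ^+ 2)).
  by rewrite ler_piMr ?sqr_ge0//; lra.
apply: (@le_trans _ _ (((x ^+ 2) ^+ k.+1) ^+ 2)).
  by rewrite ler_pXn2r// ?nnegrE ?subr_ge0// exprn_ge0 ?sqr_ge0.
by rewrite -exprM ler_wiXn2l ?sqr_ge0// muln2 -addnn addSn ltnS leq_addl.
Qed.

(** At [i = 0] the division by zero yields 0, so the constant term vanishes. *)
Definition antideriv (p : {poly R}) : {poly R} :=
  \poly_(i < (size p).+1) (p`_i.-1 / i%:R).

Lemma deriv_antideriv p : (antideriv p)^`() = p.
Proof.
apply/polyP => i; rewrite coef_deriv coef_poly ltnS /=.
case: ltnP => hi; last by rewrite mul0rn nth_default.
by rewrite -[LHS]mulr_natr divfK// pnatr_eq0.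
Qed.

Lemma derive_ge (f f' : R -> R) (m a b : R) :
  (forall z : R, is_derive z (1 : R) f (f' z)) -> a <= b ->
  (forall z, a <= z <= b -> m <= f' z) -> m * (b - a) <= f b - f a.
Proof.
move=> df ab hm; have cf : continuous f.
  by move=> z; have [/derivable1_diffP/differentiable_continuous h _] := df z; exact: h.
have [c] := @MVT_segment _ f f' a b ab (fun z _ => df z) (continuous_subspaceT cf).
by rewrite in_itv/= => cab ->; rewrite ler_wpM2r ?subr_ge0// hm.
Qed.

(** Composed with cos, minus the antiderivative is nondecreasing on [0, pi] with slope close to 1
    away from 0 and pi, where |cos| stays below 1. Only short margins at the two ends are lost. *)
Lemma arccos_approx (e : R) : 0 < e -> exists k, forall t : R, 0 <= t <= pi ->
  t - e <= (antideriv (invsqrt_poly k)).[1] - (antideriv (invsqrt_poly k)).[cos t].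
Proof.
(* This makes two margins of width [d] fit into [0, pi]. *)
wlog e1 : e / e <= 1 => [H e0|e0].
  have [||k hk] := H (Num.min e 1); first by rewrite ge_min lexx orbT.
    by rewrite lt_min e0 ltr01.
  exists k => t /hk; apply: le_trans; rewrite lerD2l lerN2.
  by rewrite ge_min lexx.
(* The loss [e] is spent as [d] at each end of [0, pi] and [e / 2] in between. *)
pose d := e / 4.
have pi2 := @pi_ge2 R.
have d0 : 0 < d by rewrite divr_gt0.
have dpi : d < pi by rewrite /d; lra.
have rho1 : cos d ^+ 2 < 1.
  have := cos2Dsin2 d; have : 0 < sin d by apply: sin_gt0_pi; rewrite d0.
  by move=> s0; have := exprn_gt0 2 s0; lra.
have eta0 : 0 < e / (2 * pi) by rewrite divr_gt0// mulr_gt0// pi_gt0.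
have [k hk] : exists k, (cos d ^+ 2) ^+ k.+1 <= e / (2 * pi).
  have := @cvg_expr R (cos d ^+ 2); rewrite ger0_norm ?sqr_ge0// => /(_ rho1).
  move=> /cvgr_le/(_ _ eta0) [N _ hN]; exists N; apply: hN => /=.
  exact: leqnSn.
exists k => t /andP[t0 tpi].
pose Q := antideriv (invsqrt_poly k).
pose f (s : R) := - Q.[cos s].
have df (s : R) : is_derive s (1 : R) f ((invsqrt_poly k).[cos s] * sin s).
  have dQ : is_derive (cos s) (1 : R) (horner Q) ((invsqrt_poly k).[cos s]).
    split; first exact: derivable_horner.
    by rewrite -derive1E -derivE deriv_antideriv.
  have hc := is_deriveN (is_derive1_comp dQ (is_derive_cos s)).
  by apply: is_derive_eq hc _; rewrite mulrN opprK.
have slope (s : R) : 0 <= s <= pi ->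
    0 <= (invsqrt_poly k).[cos s] * sin s /\
    1 - (cos s ^+ 2) ^+ k.+1 <= (invsqrt_poly k).[cos s] * sin s.
  move=> hs; have s0 := sin_ge0_pi hs.
  have c1 : -1 <= cos s <= 1 by rewrite cos_geN1 cos_le1.
  have [v1] := invsqrt_polyP k c1.
  have -> : 1 - cos s ^+ 2 = sin s ^+ 2 by rewrite -(cos2Dsin2 s) addrC addKr.
  set v := (invsqrt_poly k).[_] in v1 *.
  rewrite -exprMn; have vs0 : 0 <= v * sin s by rewrite mulr_ge0// (le_trans _ v1).
  move: (v * sin s) vs0 => y y0 y1 yk; split=> //.
  (* Since 0 <= y <= 1, y is at least y^2, and the lower bound is known for y^2. *)
  have y1' : y <= 1 by rewrite -(@expr_le1 _ 2).
  by nra.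
have mono a b : 0 <= a -> a <= b -> b <= pi -> f a <= f b.
  move=> a0 ab bpi; rewrite -subr_ge0.
  have := @derive_ge f _ 0 a b df ab; rewrite mul0r; apply => z /andP[az zb].
  by have [] := slope z; rewrite // (le_trans a0 az) (le_trans zb bpi).
suff : t - e <= f t - f 0 by rewrite /f cos0 opprK [X in _ <= X]addrC.
have [td|dt] := leP t d.
  have := mono 0 t (lexx _) t0 tpi; move: td; rewrite /d; lra.
(* The slope is integrated from [d] to [t'] only; monotonicity covers what remains on either
   side. *)
pose t' := Num.min t (pi - d).
have dt' : d <= t' by rewrite le_min ltW//= /d; lra.
have t't : t' <= t by rewrite ge_min lexx.
have t'pi : t' <= pi - d by rewrite ge_min lexx orbT.
have t'd : t - d <= t'.
  by rewrite le_min lerBlDr lerDl ltW//= lerD2r.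
have h1 := mono 0 d (lexx _) (ltW d0) (ltW dpi).
have h2 := mono t' t (le_trans (ltW d0) dt') t't tpi.
have h3 : (1 - e / (2 * pi)) * (t' - d) <= f t' - f d.
  apply: (derive_ge df dt') => z /andP[dz zt'].
  have zpi : 0 <= z <= pi by rewrite (le_trans (ltW d0) dz); lra.
  have [_] := slope z zpi; apply: le_trans; rewrite lerD2l lerN2.
  apply: le_trans hk; rewrite lerXn2r ?nnegrE ?sqr_ge0//.
  have cle : cos z <= cos d.
    by rewrite leNgt ltr_cos ?in_itv/= ?zpi// ?(ltW d0) ?(ltW dpi)// -leNgt.
  have cge : - cos d <= cos z.
    rewrite -cosN -[X in X <= _]cosDpi addrC leNgt ltr_cos ?in_itv/= ?zpi//; last first.
      by lra.
    by rewrite -leNgt; lra.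
  by nra.
have pi0 := @pi_gt0 R.
have h4 : e / (2 * pi) * (t' - d) <= e / 2.
  have -> : e / 2 = e / (2 * pi) * pi.
    by move: (pi) pi0 => p p0; field; rewrite lt0r_neq0.
  by apply: ler_wpM2l; [exact: ltW|lra].
by move: h1 h2 h3 h4 t'd; rewrite /d mulrBl mul1r; lra.
Qed.

End Arccos.

(** * Comparison of lengths *)

Section Main.
Local Open Scope complex_scope.
Local Open Scope sesquilinear_scope.
Context {R : realType}.
Local Notation C := R[i].
Local Notation normc := Normc.normc.
Local Notation mu := (@lebesgue_measure R).

Lemma derive1nN (f : R -> R) : (forall k t, derivable (derive1n k f) t 1) ->
  forall k, derive1n k (fun x => - f x) = fun x => - derive1n k f x.
Proof.
move=> hf; elim=> [//|k IH].
change (derive1 (derive1n k (fun x => - f x)) = fun x => - derive1 (derive1n k f) x).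
rewrite IH.
by apply/funext => x; rewrite !derive1E; exact: deriveN (hf k x).
Qed.

Lemma smooth_imul n (f : R -> 'M[C]_n) : smooth f -> smooth (fun t => 'i%C *: f t).
Proof.
move=> /smooth_part hf; apply/smooth_part => -[] i j k t.
  have -> : (fun x => part true (('i%C *: f x) i j)) =
      fun x => - part false (f x i j).
    by apply/funext => x; rewrite mxE; case: (f x i j) => a b /=; rewrite mul0r mul1r sub0r.
  rewrite (derive1nN (hf false i j)); apply: derivableN; exact: hf.
have -> : (fun x => part false (('i%C *: f x) i j)) = fun x => part true (f x i j).
  by apply/funext => x; rewrite mxE; case: (f x i j) => a b /=; rewrite mul0r mul1r add0r.
exact: hf.
Qed.

Lemma is_derive_mulr_cst (c t : R) : is_derive t (1 : R) (fun x : R => x * c) c.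
Proof.
have h := is_deriveM (is_derive_id t (1 : R)) (is_derive_cst c t (1 : R)).
by apply: is_derive_eq h _; rewrite scaler0 add0r [_ *: _]mulr1.
Qed.

Lemma part_line n (Z : 'M[C]_n) i j b :
  (fun t : R => part b ((t%:C *: Z) i j)) = fun t => t * part b (Z i j).
Proof. by apply/funext => t; rewrite mxE partZ. Qed.

Lemma smooth_line n (Z : 'M[C]_n) : smooth (fun t : R => t%:C *: Z).
Proof.
apply/smooth_part => b i j [|k] t; rewrite part_line.
  by have [] := is_derive_mulr_cst (part b (Z i j)) t.
rewrite /derive1n iterSr -/(derive1n k _).
have -> : derive1 (fun t : R => t * part b (Z i j)) = fun=> part b (Z i j).
  by apply/funext => x; rewrite derive1E; have [_ ->] := is_derive_mulr_cst (part b (Z i j)) x.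
by have [d ->] := derive1n_cst k (part b (Z i j)); exact: derivable_cst.
Qed.

Lemma velocity_line n (Z : 'M[C]_n) t : velocity (fun t : R => t%:C *: Z) t = Z.
Proof.
apply/matrixP => i j; apply: part_inj => b.
rewrite velocity_part part_line derive1E.
by have [_ ->] := is_derive_mulr_cst (part b (Z i j)) t.
Qed.

Lemma smooth_on_exp_curve n (X : R -> 'M[C]_n) :
  smooth_on 0 1 X -> smooth_on 0 1 (exp_curve X).
Proof.
move=> [x [sx Xx]]; exists (fun t => mexp ('i%C *: x t)); split.
  by apply: smooth_mexp; exact: smooth_imul.
by move=> t t01; rewrite /exp_curve Xx.
Qed.

Lemma smooth_on_piecewise n (X : R -> 'M[C]_n) :
  smooth_on 0 1 X -> piecewise_smooth X.
Proof.
move=> sX; exists [:: 1]; split; first exact: itv_partition1.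
by case.
Qed.

Lemma curve_length_oo n (X : R -> 'M[C]_n) : smooth_on 0 1 X ->
  curve_length X = (\int[mu]_(t in `]0%R, 1%R[) (trace_norm (velocity X t))%:E)%E.
Proof.
move=> sX; rewrite /curve_length integral_itv_bndoo; first by [].
by apply/measurable_EFinP; exact: measurable_speed sX.
Qed.

(** The speeds are compared at interior points, where both velocities are those of smooth
    extensions. *)
Lemma curve_length_exp n (X : R -> 'M[C]_n) :
  smooth_on 0 1 X -> lies_in hermitian_set X ->
  (curve_length (exp_curve X) <= curve_length X)%E.
Proof.
move=> sX hX; have sE := smooth_on_exp_curve sX.
rewrite (curve_length_oo sX) (curve_length_oo sE).
have [x [sx Xx]] := sX; have [e [se Ee]] := sE.
apply: ge0_le_integral.
- exact: measurable_itv.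
- by move=> t _; rewrite lee_fin trace_norm_ge0.
- by apply/measurable_EFinP; exact: measurable_speed sE.
- by apply/measurable_EFinP; exact: measurable_speed sX.
- move=> t /= t01; rewrite lee_fin (velocity_itv Xx t01) (velocity_itv Ee t01).
  apply: trace_norm_derive_exp (smooth_mxderive t sx) (smooth_mxderive t se).
  apply: filterS (near_itv_oo t01) => s s01; rewrite -Xx// -Ee//; split=> //.
  exact: hX.
Qed.

Lemma curve_length_line n (Z : 'M[C]_n) :
  curve_length (fun t : R => t%:C *: Z) = (trace_norm Z)%:E.
Proof.
rewrite /curve_length; under eq_integral do rewrite velocity_line.
rewrite (integral_cst mu); last exact: measurable_itv.
have := @lebesgue_measure_itv R `[0, 1].
by rewrite /= lte_fin ltr01 oppr0 adde0 => ->; rewrite mule1.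
Qed.

Lemma minimal_hermitian_length n (Y : R -> 'M[C]_n) :
  minimal_curve hermitian_set Y -> Y 0 = 0 ->
  (curve_length Y <= (trace_norm (Y 1))%:E)%E.
Proof.
move=> [_ hY minY] Y0; rewrite -curve_length_line.
have h1 : Y 1 \is hermsymmx by apply: hY; rewrite ler01 lexx.
apply: minY; last 2 first.
- by rewrite scale0r Y0.
- by rewrite scale1r.
- apply: smooth_on_piecewise; exists (fun t : R => t%:C *: Y 1); split=> //.
  exact: smooth_line.
- move=> t _; apply/is_hermitianmxP; rewrite expr0 scale1r.
  move/is_hermitianmxP: h1; rewrite expr0 scale1r => h1.
  by rewrite linearZ /= map_mxZ /= -h1 [Num.conj _]conjc_real.
Qed.

(** Column [j] of [V^t*] is a unit eigenvector for [m j], so it gives a member of the set whose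
    supremum is the norm. *)
Lemma spectral_norm_eigenvalue n (V : 'M[C]_n) (m : 'I_n -> R) j :
  V \is unitarymx ->
  `|m j| <= spectral_norm (V^t* *m diag_mx (\row_j (m j)%:C) *m V).
Proof.
move=> Vu; set A := _ *m V.
pose v : 'cV[C]_n := col j (V^t*).
have l2_sqr (w : 'cV[C]_n) : l2norm w ^+ 2 = \sum_i normc (w i 0) ^+ 2.
  by rewrite sqr_sqrtr// sumr_ge0// => i _; rewrite exprn_ge0// normc_ge0.
have l2_ge0 (w : 'cV[C]_n) : 0 <= l2norm w by exact: sqrtr_ge0.
have l2_entry (w : 'cV[C]_n) i : normc (w i 0) <= l2norm w.
  rewrite -(@ler_pXn2r _ 2) ?nnegrE ?normc_ge0 ?l2_ge0// l2_sqr (bigD1 i)//=.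
  by rewrite lerDl sumr_ge0// => k _; rewrite exprn_ge0// normc_ge0.
have v1 : l2norm v = 1.
  apply/eqP; rewrite -(@eqrXn2 _ 2)// ?ler01// expr1n l2_sqr; apply/eqP.
  apply: complexI; have /row_unitarymxP/(_ j j) := Vu; rewrite eqxx => h.
  transitivity (dotmx (row j V) (row j V)); last by rewrite h.
  rewrite dotmx_sqr rmorph_sum; apply: eq_bigr => i _ /=.
  by rewrite rmorphXn /= -normC_normc !mxE norm_conjC.
have Av : A *m v = (m j)%:C *: v.
  rewrite /A /v colE !mulmxA (mulmxtVK _ Vu) -mulmxA.
  have -> : diag_mx (\row_j (m j)%:C) *m delta_mx j 0 =
     (m j)%:C *: delta_mx j 0 :> 'cV[C]_n.
    apply/matrixP => i k; rewrite mul_diag_mx !mxE.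
    by have [->//|] := eqVneq i j; rewrite /= !mulr0.
  by rewrite -scalemxAr.
have lAv : l2norm (A *m v) = `|m j|.
  rewrite Av; apply/eqP; rewrite -(@eqrXn2 _ 2)//; apply/eqP.
  rewrite l2_sqr; under eq_bigr do rewrite mxE Normc.normcM exprMn.
  rewrite -mulr_sumr -l2_sqr v1 expr1n mulr1; congr (_ ^+ 2).
  by apply: complexI; rewrite -normC_normc normc_def /= expr0n addr0 sqrtr_sqr.
rewrite -lAv; apply: ub_le_sup; last first.
  by exists v => //=; rewrite v1.
(* [sup] dominates its set only if the set is bounded; the row sums of moduli provide a bound. *)
exists (Num.sqrt (\sum_i (\sum_k normc (A i k)) ^+ 2)) => _ [w /= w1 <-].
apply: ler_wsqrtr; apply: ler_sum => i _.
rewrite ler_pXn2r ?nnegrE ?normc_ge0//; last first.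
  by rewrite sumr_ge0// => k _; exact: normc_ge0.
rewrite mxE; apply: le_trans (normc_sum _ _) _; apply: ler_sum => k _.
rewrite Normc.normcM ler_piMr ?normc_ge0//.
exact: le_trans (l2_entry _ _) w1.
Qed.

Lemma unitary_length_ge n (V : 'M[C]_n) (m : 'I_n -> R) (f : R -> 'M[C]_n) :
  V \is unitarymx -> (forall j, `|m j| <= pi) ->
  piecewise_smooth f -> lies_in unitary_set f -> f 0 = 1%:M ->
  f 1 = V^t* *m diag_mx (\row_j cis (m j)) *m V ->
  ((\sum_j `|m j|)%:E <= curve_length f)%E.
Proof.
move=> Vu mpi pf uf f0 f1; apply/lee_addgt0Pr => e e0.
(* Each of the [n] eigenvalues costs this much, for a total of at most [e]; the successor covers
   [n = 0]. *)
have e1 : 0 < e / n.+1%:R by rewrite divr_gt0.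
have [k hk] := arccos_approx e1.
set Q := antideriv (invsqrt_poly k) in hk.
have slope (x : R) : -1 <= x <= 1 -> Q^`().[x] ^+ 2 * (1 - x ^+ 2) <= 1.
  by move=> /(invsqrt_polyP k) []; rewrite /Q deriv_antideriv.
have := energy_length slope pf uf.
have energyE (d : 'rV[C]_n) : energy Q (V^t* *m diag_mx d *m V) =
    - \sum_j Q.[complex.Re (d 0 j)].
  rewrite /energy cosmx_spectral (pmx_spectral _ (fun j => complex.Re (d 0 j)) Vu).
  rewrite -{2}[V]trmxCK mxtrace_conj ?trmxC_unitary//.
  rewrite mxtrace_diag -[complex.Re _]/(part true _) part_sum; congr (- _).
  by apply: eq_bigr => j _; rewrite !mxE.
(* The identity is written in the same eigenbasis as [f 1], so that [energyE] evaluates both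
   ends. *)
have -> : f 0 = V^t* *m diag_mx (const_mx 1) *m V.
  by rewrite f0 diag_const_mx mulmx1 unitarymxKt.
rewrite f1 !energyE opprK => /(leeD2r e%:E); apply: le_trans.
rewrite -EFinD lee_fin [- _ + _]addrC -sumrB -lerBlDr.
apply: (@le_trans _ _ (\sum_j (`|m j| - e / n.+1%:R))).
  rewrite sumrB lerD2l lerN2 sumr_const card_ord -[leLHS]mulr_natl mulrCA.
  by rewrite ler_piMr ?ltW// ltr_pdivrMr// mul1r ltr_nat.
apply: ler_sum => j _; rewrite !mxE /=.
(* Evenness of cos moves the angle into [0, pi], where [hk] applies. *)
have -> : cos (m j) = cos `|m j|.
  by case: (ger0P (m j)) => _; rewrite ?cosN.
by apply: hk; rewrite normr_ge0 mpi.
Qed.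

End Main.

Theorem theorem4p17 (R : realType) (n : nat) :
  (forall X : R -> 'M[R[i]]_n,
     smooth_on 0 1 X -> lies_in hermitian_set X ->
     (curve_length (exp_curve X) <= curve_length X)%E) /\
  (forall Y : R -> 'M[R[i]]_n,
     smooth_on 0 1 Y -> lies_in hermitian_set Y ->
     minimal_curve hermitian_set Y ->
     Y 0 = 0 -> spectral_norm (Y 1) <= pi ->
     minimal_curve unitary_set (exp_curve Y)).
Proof.
split=> [X|Y sY hY minY Y0 Ypi]; first exact: curve_length_exp.
split.
- exact: smooth_on_piecewise (smooth_on_exp_curve sY).
- by move=> t t01; apply: mexp_hermitian_unitary; exact: hY.
move=> g pg ug g0 g1.
(* The chain is L(e^{iY}) <= L(Y) <= |Y(1)|_1 <= sum of |m_j| <= L(g), where the m_j are the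
   eigenvalues of [Y 1]. *)
apply: le_trans (curve_length_exp sY hY) _.
apply: le_trans (minimal_hermitian_length minY Y0) _.
have h1 : Y 1 \is hermsymmx by apply: hY; rewrite ler01 lexx.
have [V [m [Vu Y1E]]] := hermitian_diagonalization h1.
apply: (@le_trans _ _ (\sum_j `|m j|)%:E).
  rewrite lee_fin Y1E; apply: le_trans (trace_norm_spectral _ Vu) _.
  apply: ler_sum => j _; rewrite mxE -lecR -normC_normc normc_def /=.
  by rewrite expr0n addr0 sqrtr_sqr.
apply: (unitary_length_ge Vu) pg ug _ _.
- move=> j; apply: le_trans Ypi; rewrite Y1E; exact: spectral_norm_eigenvalue.
- by rewrite g0 /exp_curve Y0 scaler0 mexp0.
by rewrite g1 /exp_curve Y1E (mexp_spectral m Vu).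
Qed.
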